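(* For $x\in(0,\infty)$, the game $\mathrm{Standard}(x)=\mathrm{Trail}(0,1,x,0)$ has a time-invariant Nash equilibrium if and only if $x\in[\lambda,\lambda^{-1}]$.
   Context: Trail of Lost Pennies $\mathrm{Trail}(m_{-\infty},m_\infty,n_{-\infty},n_\infty)$ (data with $m_{-\infty}<m_\infty$, $n_\infty<n_{-\infty}$, and fixed reals $m_*\le m_{-\infty}$, $n_*\le n_\infty$): a strategy is a map $S:\mathbb{Z}\times\mathbb{N}_+\to[0,\infty)$, time-invariant if $S(i,j)$ does not depend on $j$. For a strategy pair $(S_-,S_+)$ (Mina's, Maxine's) and $k\in\mathbb{Z}$, gameplay $X:\mathbb{N}\to\mathbb{Z}$ has $X_0=k$ and, given the past, steps $+1$ with probability $\frac{S_+(X_{i-1},i)}{S_-(X_{i-1},i)+S_+(X_{i-1},i)}$ and $-1$ otherwise ($0/0=1/2$). With $E_-=\{\limsup X_n=-\infty\}$, $E_+=\{\liminf X_n=\infty\}$, $E=E_-\cup E_+$: Mina's payoff $P_-=-\sum_{t\ge1}S_-(X_{t-1},t)+T_-$, $T_-=n_{-\infty},n_\infty,n_*$ on $E_-,E_+,E^c$; Maxine's payoff $P_+=-\sum_{t\ge1}S_+(X_{t-1},t)+T_+$, $T_+=m_{-\infty},m_\infty,m_*$ on $E_-,E_+,E^c$. $(S_-,S_+)$ is a Nash equilibrium if for every strategy $S$ and every starting point $k$, $\mathbb{E}^k_{S_-,S_+}[P_+]\ge\mathbb{E}^k_{S_-,S}[P_+]$ and $\mathbb{E}^k_{S_-,S_+}[P_-]\ge\mathbb{E}^k_{S,S_+}[P_-]$.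 ABMN system on $\mathbb{Z}$: variables $a_i,b_i\ge0$, $m_i,n_i\in\mathbb{R}$ with, for all $i$, $(a_i+b_i)(m_i+a_i)=a_im_{i+1}+b_im_{i-1}$, $(a_i+b_i)(n_i+b_i)=a_in_{i+1}+b_in_{i-1}$, $(a_i+b_i)^2=b_i(m_{i+1}-m_{i-1})$, $(a_i+b_i)^2=a_i(n_{i-1}-n_{i+1})$; positive if all $a_i,b_i>0$; the Mina margin is $\frac{n_{-\infty}-n_\infty}{m_\infty-m_{-\infty}}$ where $m_{\pm\infty},n_{\pm\infty}$ are the limits of $m_i,n_i$ as $i\to\pm\infty$. $\lambda\in(0,1]$ denotes the infimum of the Mina margins of positive ABMN solutions (the set of these margins is $[\lambda,\lambda^{-1}]$). *)

(* Defs.v *)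
From HB Require Import structures.
From mathcomp Require Import all_boot all_order all_algebra.
From mathcomp Require Import all_classical all_reals all_analysis.
Set Implicit Arguments. Unset Strict Implicit. Unset Printing Implicit Defensive.
Import Order.TTheory GRing.Theory Num.Theory.
Import numFieldNormedType.Exports.
Local Open Scope classical_set_scope.
Local Open Scope ring_scope.

Section Trail.
Variable R : realType.

(** A strategy: a map Z x N_+ -> [0,oo). We use [int -> nat -> R]; only
    the values at times j >= 1 matter (the value at j = 0 is never used). *)
Definition strategy := int -> nat -> R.

Definition is_strategy (S : strategy) : Prop :=
  forall (i : int) (j : nat), (0 < j)%N -> 0 <= S i j.

Definition time_invariant (S : strategy) : Prop :=
  forall (i : int) (j j' : nat), (0 < j)%N -> (0 < j')%N -> S i j = S i j'.

Definition up_prob (Sm Sp : strategy) (i : int) (j : nat) : R :=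
  if Sm i j + Sp i j == 0 then 1 / 2 else Sp i j / (Sm i j + Sp i j).

(** Gameplay realised on the probability space ([0,1], Lebesgue measure):
    the standard nested-interval construction.  The state at time n is
    (X_n, a_n, b_n) with u in [a_n, b_n); the interval [a_n,b_n) is split
    in proportions p : 1-p, where p is the probability of the up-step at
    time n+1, and the walk moves up iff u falls in the left part.  Hence
    P(X_0 = k, X_1 = x_1, ..., X_n = x_n) is the product of the transition
    probabilities, i.e. X is the gameplay started at k. *)
Fixpoint gp_state (Sm Sp : strategy) (k : int) (u : R) (n : nat)
  : int * R * R :=
  match n with
  | O => (k, 0, 1)
  | n'.+1 =>
      let: (x, a, b) := gp_state Sm Sp k u n' in
      let c := a + up_prob Sm Sp x n'.+1 * (b - a) in
      if u < c then (x + 1, a, c) else (x - 1, c, b)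
  end.

Definition gameplay (Sm Sp : strategy) (k : int) (u : R) (n : nat) : int :=
  (gp_state Sm Sp k u n).1.1.

Definition escapes_minus (X : nat -> int) : Prop :=
  limn_esup (fun n => ((X n)%:~R : R)%:E) = -oo%E.
Definition escapes_plus (X : nat -> int) : Prop :=
  limn_einf (fun n => ((X n)%:~R : R)%:E) = +oo%E.

Definition terminal (vminus vplus vstar : R) (X : nat -> int) : \bar R :=
  if `[< escapes_minus X >] then vminus%:E
  else if `[< escapes_plus X >] then vplus%:E
  else vstar%:E.

Definition running_cost (S : strategy) (X : nat -> int) : \bar R :=
  (\sum_(t <oo) (S (X t) t.+1)%:E)%E.

Definition payoff_minus (nmi npi nst : R) (Sm : strategy) (X : nat -> int)
  : \bar R := (terminal nmi npi nst X - running_cost Sm X)%E.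
Definition payoff_plus (mmi mpi mst : R) (Sp : strategy) (X : nat -> int)
  : \bar R := (terminal mmi mpi mst X - running_cost Sp X)%E.

Definition exp_payoff_minus (nmi npi nst : R) (Sm Sp : strategy) (k : int)
  : \bar R :=
  (\int[lebesgue_measure]_(u in `[0%R, 1%R]) payoff_minus nmi npi nst Sm
                                            (gameplay Sm Sp k u))%E.
Definition exp_payoff_plus (mmi mpi mst : R) (Sm Sp : strategy) (k : int)
  : \bar R :=
  (\int[lebesgue_measure]_(u in `[0%R, 1%R]) payoff_plus mmi mpi mst Sp
                                            (gameplay Sm Sp k u))%E.

(** Nash equilibrium of Trail(m_{-oo}, m_oo, n_{-oo}, n_oo) with
    end-values m_*, n_* for the unterminated game. *)
Definition nash_equilibrium (mmi mpi nmi npi mst nst : R)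
  (Sm Sp : strategy) : Prop :=
  is_strategy Sm /\ is_strategy Sp /\
  forall (S : strategy), is_strategy S -> forall k : int,
    (exp_payoff_plus mmi mpi mst Sm S k <= exp_payoff_plus mmi mpi mst Sm Sp k)%E
    /\ (exp_payoff_minus nmi npi nst S Sp k
          <= exp_payoff_minus nmi npi nst Sm Sp k)%E.

Definition ABMN (a b m n : int -> R) : Prop :=
  forall i : int,
    [/\ 0 <= a i /\ 0 <= b i,
     (a i + b i) * (m i + a i) = a i * m (i + 1) + b i * m (i - 1),
     (a i + b i) * (n i + b i) = a i * n (i + 1) + b i * n (i - 1),
     (a i + b i) ^+ 2 = b i * (m (i + 1) - m (i - 1)) &
     (a i + b i) ^+ 2 = a i * (n (i - 1) - n (i + 1))].

Definition positive_ABMN (a b m n : int -> R) : Prop :=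
  ABMN a b m n /\ forall i, 0 < a i /\ 0 < b i.

Definition lim_pinfty (f : int -> R) (l : R) : Prop :=
  (fun k : nat => f k%:Z) @ \oo --> l.
Definition lim_minfty (f : int -> R) (l : R) : Prop :=
  (fun k : nat => f (- k%:Z)) @ \oo --> l.

Definition mina_margin (m n : int -> R) (r : R) : Prop :=
  exists mmi mpi nmi npi : R,
    [/\ lim_minfty m mmi, lim_pinfty m mpi, lim_minfty n nmi,
        lim_pinfty n npi & r = (nmi - npi) / (mpi - mmi)].

Definition positive_margins : set R :=
  [set r | exists a b m n, positive_ABMN a b m n /\ mina_margin m n r].

Definition lambda : R := inf positive_margins.

End Trail.

(* Main.v *)
Require Import Defs.
From HB Require Import structures.
From mathcomp Require Import all_boot all_order all_algebra.
From mathcomp Require Import all_classical all_reals all_analysis.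
From mathcomp Require Import measurable_realfun.
From mathcomp Require Import ring lra zify.
Set Implicit Arguments. Unset Strict Implicit. Unset Printing Implicit Defensive.
Import Order.TTheory GRing.Theory Num.Theory.
Import numFieldNormedType.Exports.
Local Open Scope classical_set_scope.
Local Open Scope ring_scope.

(** Write [a i] and [b i] for the stakes of Maxine and Mina at [i]. Positive ABMN
    solutions are exactly the solutions of the gap equations
    [m (i+1) - m i = 2 a i + b i], [m i - m (i-1) = (a i)^2 / b i] and their mirror
    images for [n]. Hence [rho i = b i / a i] obeys a one-dimensional recursion
    [rho (i+1) = T (rho i)] with [T r <= r / 4], a solution is determined up to
    affine changes by [rho 0 = t], and its Mina margin is a continuous function
    [margin t] with [margin t^-1 = (margin t)^-1]. Every orbit of [T] meets
    [[1/5, 5]], so the set of margins is the compact interval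
    [[lambda, lambda^-1]].

    From a solution with limits [(0, 1, x, 0)] to an equilibrium: against [b], any
    strategy of Maxine makes [m (X t)] minus her cost a supermartingale, and Fatou's
    lemma bounds her payoff by [m k]. With the stakes [a] it is a bounded
    martingale, so the total cost is finite almost surely; since each visit to [i]
    costs [a i > 0], no site is visited infinitely often, the walk escapes, and
    dominated convergence gives the payoff [m k].

    Conversely, let [m] and [n] be the values of a time-invariant equilibrium.
    Deviations in the first turn only show that at each site either both stakes
    vanish, and then [m] is nonincreasing and [n] nondecreasing there, or both are
    positive and the gap equations hold. So the stakes are zero everywhere or
    positive everywhere. The first case is refuted by arbitrarily cheap strategies
    that always win; in the second, comparing the two martingale representations of
    the payoffs identifies the limits of [m] and [n]. *)

(** * Affine change of variable for Lebesgue integrals *)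

Section ChangeOfVariable.
Variable R : realType.
Local Notation mu := (@lebesgue_measure R).

Lemma affine_preimage_ocitv (e d : R) (x y : R) : 0 < d ->
  (fun u : R => (u - e) / d) @^-1` `]x, y] = `]e + d * x, e + d * y]%classic.
Proof.
move=> d0; apply/seteqP; split=> u /=; rewrite !in_itv/=;
  by rewrite ltr_pdivlMr// ler_pdivrMr// ltrBrDl lerBlDl ![_ * d]mulrC.
Qed.

Lemma measurable_affine (e d : R) :
  measurable_fun setT (fun u : R => (u - e) / d : measurableTypeR R).
Proof. by apply: measurable_funM => //; exact: measurable_funB. Qed.

(** Lebesgue measure is characterised by its values on half-open intervals, so it equals its image
    under the affine map rescaled by [d^-1]. *)
Lemma ge0_integral_affine (e d : R) (D : set R) (f : R -> \bar R) : 0 < d ->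
  measurable D -> measurable_fun setT f -> (forall u, (0 <= f u)%E) ->
  (\int[mu]_(u in (fun u : R => ((u - e) / d)%R) @^-1` D) f ((u - e) / d)%R
   = d%:E * \int[mu]_(u in D) f u)%E.
Proof.
move=> d0 mD mf f0.
pose phi : measurableTypeR R -> measurableTypeR R := fun u => (u - e) / d.
have mphi : measurable_fun setT phi by exact: measurable_affine.
have dV0 : 0 <= d^-1 by rewrite invr_ge0 ltW.
have @nu0 : {measure set (measurableTypeR R) -> \bar R}.
  refine (pushforward mu phi : {measure set (measurableTypeR R) -> \bar R}); exact: mphi.
pose nu : {measure set (measurableTypeR R) -> \bar R} := mscale (NngNum dV0) nu0.
(* [nu] is this rescaled image; uniqueness reduces the claim to intervals []x, y]]. *)
have nuE A : measurable A -> mu A = nu A.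
  apply: lebesgue_measure_unique => X [[x y] _ <-].
  have -> : nu `]x, y]%classic = (d^-1%:E * mu `](e + d * x)%R, (e + d * y)%R])%E.
    by rewrite -affine_preimage_ocitv.
  rewrite !lebesgue_measure_itv/= !lte_fin ltrD2l ltr_pM2l//.
  case: ifPn => _; last by rewrite mule0.
  by rewrite -!EFinD -EFinM; congr (_%:E); field; rewrite gt_eqF.
transitivity (\int[nu0]_(u in D) f u)%E.
  apply/esym; apply: (ge0_integral_pushforward mphi mu mD) => //.
  exact: measurable_funTS.
have -> : (\int[mu]_(u in D) f u = \int[nu]_(u in D) f u)%E.
  by apply: eq_measure_integral => A mA _; rewrite -?nuE.
have -> : (\int[nu]_(u in D) f u = d^-1%:E * \int[nu0]_(u in D) f u)%E.
  by apply: (ge0_integral_mscale nu0 mD) => //; exact: measurable_funTS.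
by rewrite muleA -EFinM divff ?gt_eqF// mul1e.
Qed.

End ChangeOfVariable.

(** * The nested-interval gameplay and its first-step decomposition *)

Section Gameplay.
Variable R : realType.
Implicit Types (Sm Sp S : strategy R) (k : int) (u : R) (X : nat -> int).
Local Notation mu := (@lebesgue_measure R).

Definition tail_strategy S : strategy R := fun i j => S i j.+1.
Definition path_cons k X : nat -> int := fun n => if n is n'.+1 then X n' else k.

(** A common form for all expectations below; both expected payoffs of the game unfold to it. *)
Definition expect Sm Sp k (F : (nat -> int) -> \bar R) : \bar R :=
  (\int[mu]_(u in `[0%R, 1%R]) F (gameplay Sm Sp k u))%E.

Lemma tail_is_strategy S : is_strategy S -> is_strategy (tail_strategy S).
Proof. by move=> hS i j _; exact: hS. Qed.

Lemma up_prob_ge0 Sm Sp i j : is_strategy Sm -> is_strategy Sp -> (0 < j)%N ->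
  0 <= up_prob Sm Sp i j.
Proof.
move=> hm hp j0; rewrite /up_prob; case: ifP => _; first by rewrite divr_ge0.
by rewrite divr_ge0// ?addr_ge0// ?hm// hp.
Qed.

Lemma up_prob_le1 Sm Sp i j : is_strategy Sm -> is_strategy Sp -> (0 < j)%N ->
  up_prob Sm Sp i j <= 1.
Proof.
move=> hm hp j0; rewrite /up_prob; case: ifPn => [_|s0].
  by rewrite ler_pdivrMr// mul1r ler1n.
have s1 : 0 < Sm i j + Sp i j by rewrite lt_neqAle eq_sym s0 addr_ge0// ?hm// hp.
by rewrite ler_pdivrMr// mul1r lerDr hm.
Qed.

Lemma gp_stateS Sm Sp k u n : gp_state Sm Sp k u n.+1 =
  let: (x, a, b) := gp_state Sm Sp k u n in
  let c := a + up_prob Sm Sp x n.+1 * (b - a) in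
  if u < c then (x + 1, a, c) else (x - 1, c, b).
Proof. by []. Qed.

(** Self-similarity: inside the interval [[e, e + d)] selected by the first step, the construction
    is the affine image of the one on [[0, 1)] for the tail strategies. *)
Lemma gp_state_affine Sm Sp k u k' e d n : 0 < d ->
  gp_state Sm Sp k u 1 = (k', e, e + d) ->
  gp_state Sm Sp k u n.+1 =
  let: (x, a, b) :=
    gp_state (tail_strategy Sm) (tail_strategy Sp) k' ((u - e) / d) n in
  (x, e + d * a, e + d * b).
Proof.
move=> d0 h1; elim: n => [|n ih]; first by rewrite h1/= mulr0 mulr1 addr0.
rewrite gp_stateS ih [in RHS]gp_stateS.
case: gp_state => -[x a] b /=.
have -> : up_prob (tail_strategy Sm) (tail_strategy Sp) x n.+1 =
  up_prob Sm Sp x n.+2 by [].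
set q := up_prob _ _ _ _.
have -> : e + d * a + q * (e + d * b - (e + d * a)) =
  e + d * (a + q * (b - a)) by ring.
rewrite ltr_pdivrMr// ltrBlDl [_ * d]mulrC.
by case: ifP.
Qed.

Lemma gameplay_up Sm Sp k u : let p := up_prob Sm Sp k 1 in
  0 < p -> u < p ->
  gameplay Sm Sp k u = path_cons k
    (gameplay (tail_strategy Sm) (tail_strategy Sp) (k + 1) ((u - 0) / p)).
Proof.
move=> p p0 up; apply/funext => -[//|n]; rewrite /gameplay/=.
have h1 : gp_state Sm Sp k u 1 = (k + 1, 0, 0 + p).
  by rewrite /= !add0r subr0 mulr1 up.
have /= -> := gp_state_affine n p0 h1.
by case: gp_state => -[].
Qed.

Lemma gameplay_down Sm Sp k u : let p := up_prob Sm Sp k 1 in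
  p < 1 -> p <= u ->
  gameplay Sm Sp k u = path_cons k
    (gameplay (tail_strategy Sm) (tail_strategy Sp) (k - 1) ((u - p) / (1 - p))).
Proof.
move=> p p1 up; apply/funext => -[//|n]; rewrite /gameplay/=.
have h1 : gp_state Sm Sp k u 1 = (k - 1, p, p + (1 - p)).
  by rewrite /= !add0r subr0 mulr1 ltNge up/=; congr (_, _, _); ring.
have d0 : 0 < 1 - p by rewrite subr_gt0.
have /= -> := gp_state_affine n d0 h1.
by case: gp_state => -[].
Qed.

Lemma gameplay_ext Sm Sp Sm' Sp' k u :
  (forall i j, (0 < j)%N -> Sm i j = Sm' i j) ->
  (forall i j, (0 < j)%N -> Sp i j = Sp' i j) ->
  gameplay Sm Sp k u = gameplay Sm' Sp' k u.
Proof.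
move=> hm hp; apply/funext => n; rewrite /gameplay; congr (_.1.1).
by elim: n => //= n ->; case: gp_state => -[x a] b; rewrite /up_prob !hm// !hp.
Qed.

(** The state space carries no sigma-algebra here, so the claim concerns predicates [Q] of state and
    [u] that are measurable in [u] for each fixed state. Unrolling the last step turns [Q] into
    another such predicate [Q'], and at time 0 the state is fixed. *)
Lemma measurable_gp_state Sm Sp k n (Q : int * R * R -> R -> Prop) :
  (forall s, measurable [set u | Q s u]) ->
  measurable [set u | Q (gp_state Sm Sp k u n) u].
Proof.
elim: n Q => [|n ih] Q mQ; first exact: mQ.
pose c (s : int * R * R) := s.1.2 + up_prob Sm Sp s.1.1 n.+1 * (s.2 - s.1.2).
pose Q' s u := if u < c s then Q (s.1.1 + 1, s.1.2, c s) u
               else Q (s.1.1 - 1, c s, s.2) u.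
rewrite [X in measurable X](_ : _ = [set u | Q' (gp_state Sm Sp k u n) u]); last first.
  apply/seteqP; split=> u /=; rewrite /Q' /c;
  by case: gp_state => -[x a] b /=; case: ifP.
apply: ih => s.
rewrite [X in measurable X](_ : _ =
  (`]-oo, c s[ `&` [set u | Q (s.1.1 + 1, s.1.2, c s) u]) `|`
  (`[c s, +oo[ `&` [set u | Q (s.1.1 - 1, c s, s.2) u])); last first.
  apply/seteqP; split=> u /=; rewrite /Q' !in_itv/= ?andbT.
    by case: ltP => ? ?; [left|right].
  by case: ltP => ? [[? ?]|[? ?]].
by apply: measurableU; apply: measurableI => //; exact: measurable_itv.
Qed.

Lemma measurable_gameplay Sm Sp k n d (T : measurableType d) (g : int -> T) :
  measurable_fun setT (fun u => g (gameplay Sm Sp k u n)).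
Proof.
move=> _ B mB; rewrite setTI.
apply: (@measurable_gp_state Sm Sp k n (fun s _ => B (g s.1.1))) => s.
by case: (pselect (B (g s.1.1))) => h;
   [rewrite [X in measurable X](_ : _ = setT)|rewrite [X in measurable X](_ : _ = set0)] => //;
   apply/seteqP; split=> u.
Qed.

(** The interval [[0, 1]] is cut at [p]; rescaling each piece to [[0, 1]] turns it into the game
    from the new position. Nonnegativity of [F] allows infinite values. *)
Lemma expect_first_step Sm Sp k (F : (nat -> int) -> \bar R) :
  is_strategy Sm -> is_strategy Sp -> (forall X, (0 <= F X)%E) ->
  (forall k', measurable_fun setT (fun u => F (path_cons k
     (gameplay (tail_strategy Sm) (tail_strategy Sp) k' u)))) ->
  measurable_fun setT (fun u => F (gameplay Sm Sp k u)) ->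
  let p := up_prob Sm Sp k 1 in
  let E' k' := expect (tail_strategy Sm) (tail_strategy Sp) k' (F \o path_cons k) in
  (expect Sm Sp k F = p%:E * E' (k + 1)%R + (1 - p)%R%:E * E' (k - 1)%R)%E.
Proof.
move=> hm hp F0 mF' mF p E'.
have p0 : 0 <= p by exact: up_prob_ge0.
have p1 : p <= 1 by exact: up_prob_le1.
rewrite /expect (@itv_bndbnd_setU _ _ _ (BLeft p)) ?bnd_simp//.
rewrite ge0_integral_setU//=; last 2 first.
- exact: measurable_funTS mF.
- rewrite disj_set2E; apply/eqP/seteqP; split=> u //= [].
  by rewrite !in_itv/= => /andP[_ ?] /andP[]; rewrite leNgt => /negP.
congr (_ + _)%E.
- move: p0; rewrite le_eqVlt => /predU1P[p0|p0].
    by rewrite -p0 mul0e set_itvE integral_set0.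
  rewrite /E' /expect -(ge0_integral_affine 0 p0 _ (mF' _))//.
  rewrite [in RHS](_ : _ @^-1` _ = `[0%R, p]%classic); last first.
    apply/seteqP; split=> u /=;
    by rewrite !in_itv/= subr0 ler_pdivlMr// ler_pdivrMr// mul0r mul1r.
  (* The point [u = p] belongs to the down-step; removing this null set leaves the integral
     unchanged. *)
  rewrite -integral_itv_bndo_bndc//=; last first.
    apply: measurable_funTS; apply: (measurableT_comp (mF' _)).
    exact: measurable_affine.
  apply: eq_integral => u; rewrite inE/= in_itv/= => /andP[_ up].
  by rewrite gameplay_up.
- move: p1; rewrite le_eqVlt => /predU1P[p1|p1].
    by rewrite p1 subrr mul0e set_itv1 integral_set1.
  have d0 : 0 < 1 - p by rewrite subr_gt0.
  rewrite /E' /expect -(ge0_integral_affine p d0 _ (mF' _))//.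
  rewrite [in RHS](_ : _ @^-1` _ = `[p, 1%R]%classic); last first.
    apply/seteqP; split=> u /=;
    by rewrite !in_itv/= ler_pdivlMr// ler_pdivrMr// mul0r mul1r subr_ge0 lerD2r.
  apply: eq_integral => u; rewrite inE/= in_itv/= => /andP[up _].
  by rewrite gameplay_down.
Qed.

End Gameplay.

(** * Escape and recurrence of nearest-neighbour paths *)

Section Paths.
Variable R : realType.
Implicit Types (S : strategy R) (k i : int) (X : nat -> int).

Lemma escapes_plusP X : escapes_plus R X <->
  forall B : int, exists N, forall n, (N <= n)%N -> B <= X n.
Proof.
rewrite /escapes_plus; set v : (\bar R)^nat := fun n => _; split.
  move=> hv B.
  have : einfs v @ \oo --> +oo%E.
    by rewrite -hv limn_einf_lim; exact: is_cvg_einfs.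
  move=> /cvgeyPge /(_ (B%:~R)) [N _ /(_ N (leqnn N)) hN].
  exists N => n Nn; rewrite -(ler_int R) -lee_fin (le_trans hN)//.
  by apply: ereal_inf_lbound; exists n.
move=> hX; suff : v @ \oo --> +oo%E by move=> /cvg_limn_einf_sup[].
apply/cvgeyPge => A.
have [N hN] := hX (Num.ceil A).
exists N => //= n Nn; rewrite lee_fin (le_trans (ceil_ge _))// ler_int; exact: hN.
Qed.

Lemma escapes_minus_opp X : escapes_minus R X <-> escapes_plus R (fun n => - X n).
Proof.
rewrite /escapes_minus /escapes_plus /limn_einf.
under [in X in _ <-> X]eq_fun do rewrite rmorphN/=.
have -> : (\- (fun n : nat => (- (X n)%:~R)%:E))%E
    = (fun n => ((X n)%:~R : R)%:E).
  by apply/funext => n; rewrite /= opprK.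
by split=> [->//|/eqP]; rewrite eqe_oppLR => /eqP.
Qed.

Lemma escapes_minusP X : escapes_minus R X <->
  forall B : int, exists N, forall n, (N <= n)%N -> X n <= B.
Proof.
rewrite escapes_minus_opp escapes_plusP; split=> h B;
  by have [N hN] := h (- B); exists N => n /hN; rewrite ?lerN2// lerNr ?opprK// lerNl.
Qed.

Lemma not_escapes_both X : escapes_minus R X -> ~ escapes_plus R X.
Proof.
move=> /escapes_minusP/(_ 0)[N hN] /escapes_plusP/(_ 1)[N' hN'].
have := hN _ (leq_maxl N N'); have := hN' _ (leq_maxr N N'); lia.
Qed.

Lemma escapes_plus_cons k X : escapes_plus R (path_cons k X) <-> escapes_plus R X.
Proof.
rewrite !escapes_plusP; split=> h B; have [N hN] := h B.
  by exists N => n Nn; apply: (hN n.+1); rewrite ltnW.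
by exists N.+1 => -[//|n] Nn; exact: hN.
Qed.

Lemma escapes_minus_cons k X : escapes_minus R (path_cons k X) <-> escapes_minus R X.
Proof.
rewrite !escapes_minusP; split=> h B; have [N hN] := h B.
  by exists N => n Nn; apply: (hN n.+1); rewrite ltnW.
by exists N.+1 => -[//|n] Nn; exact: hN.
Qed.

Definition nearest_neighbour X := forall n, X n.+1 = X n + 1 \/ X n.+1 = X n - 1.

Lemma gameplay_nearest_neighbour (Sm Sp : strategy R) k u :
  nearest_neighbour (gameplay Sm Sp k u).
Proof.
move=> n; rewrite /gameplay gp_stateS.
by case: gp_state => -[x a] b /=; case: ifP => _ /=; [left|right].
Qed.

Definition visited_io X i := forall N, exists2 n, (N <= n)%N & X n = i.

(** Pigeonhole by induction on the width of the window: if its top value [B + d] is not visited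
    infinitely often, it can be discarded from some time on. *)
Lemma bounded_io_visited X (B : int) (d : nat) :
  (forall N, exists2 n, (N <= n)%N & B < X n < B + d%:Z) -> exists i, visited_io X i.
Proof.
elim: d => [|d ih] h; first by have [n _] := h 0%N; lia.
have [hv|/existsNP[N hN]] := pselect (visited_io X (B + d%:Z)).
  by exists (B + d%:Z).
apply: ih => M; have [n Mn hn] := h (maxn M N).
exists n; first by rewrite (leq_trans _ Mn)// leq_maxl.
have : X n <> B + d%:Z.
  by move=> e; apply: hN; exists n => //; rewrite (leq_trans _ Mn)// leq_maxr.
lia.
Qed.

Lemma crossing X (B : int) n m : nearest_neighbour X -> (n <= m)%N ->
  X n <= B -> B < X m -> exists2 l, (n <= l)%N & X l = B + 1.
Proof.
move=> hX nm hn; elim: m nm => [|m ih] nm hm.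
  by move: nm; rewrite leqn0 => /eqP n0; move: hn; rewrite n0; lia.
have [hm'|hm'] := ltP B (X m).
  have [e|nm'] := eqVneq n m.+1; first by move: hn; rewrite e; lia.
  by apply: ih => //; lia.
by exists m.+1 => //; case: (hX m); lia.
Qed.

(** The path is above some [B] infinitely often and below some [B'] infinitely often. If it also
    returns to [X <= B] forever, it crosses [B + 1] infinitely often; otherwise it is eventually
    above [B] and meets the finite window between [B] and [B'] infinitely often. *)
Lemma not_escapes_visited X : nearest_neighbour X ->
  ~ escapes_minus R X -> ~ escapes_plus R X -> exists i, visited_io X i.
Proof.
move=> hX /escapes_minusP/existsNP[B /forallNP hB].
move=> /escapes_plusP/existsNP[B' /forallNP hB'].
have ioB N : exists2 n, (N <= n)%N & B < X n.
  have /existsNP[n /not_implyP[Nn hn]] := hB N; exists n => //; lia.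
have ioB' N : exists2 n, (N <= n)%N & X n < B'.
  have /existsNP[n /not_implyP[Nn hn]] := hB' N; exists n => //; lia.
have [ioB1|/existsNP[N hN]] := pselect (forall N, exists2 n, (N <= n)%N & X n <= B).
  exists (B + 1) => N; have [n Nn hn] := ioB1 N; have [m nm hm] := ioB n.
  have [l nl hl] := crossing hX nm hn hm; exists l => //; exact: leq_trans nl.
apply: (@bounded_io_visited X B `|B' - B|%N) => M.
have [n Mn hn] := ioB' (maxn M N); exists n; first by lia.
have : ~ (X n <= B) by move=> h; apply: hN; exists n => //; lia.
lia.
Qed.

Lemma running_cost_visited S X i (c : R) : is_strategy S -> 0 < c ->
  (forall j, (0 < j)%N -> c <= S i j) -> visited_io X i ->
  running_cost S X = +oo%E.
Proof.
move=> hS c0 hc hv; rewrite /running_cost.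
set f := fun t => (S (X t) t.+1)%:E.
have f0 n : (0 <= n)%N -> xpredT n -> (0 <= f n)%E by move=> *; rewrite lee_fin hS.
(* By induction, [K] visits to [i] cost at least [K * c]. *)
have hsum K : exists N, ((K%:R * c)%:E <= \sum_(0 <= t < N) f t)%E.
  elim: K => [|K [N hN]]; first by exists 0%N; rewrite big_nil mul0r.
  have [n Nn Xn] := hv N; exists n.+1.
  rewrite big_nat_recr//= -natr1 mulrDl mul1r EFinD leeD//.
    apply: le_trans hN _; rewrite [leRHS](@big_cat_nat _ _ _ N 0 n)//=.
    by rewrite leeDl// sume_ge0// => t _; rewrite lee_fin hS.
  by rewrite /f Xn lee_fin hc.
apply/eqyP => A A0.
have [N hN] := hsum (Num.trunc (A / c)).+1.
have : (A%:E <= \sum_(0 <= t < N) f t)%E.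
  apply: le_trans hN; rewrite lee_fin -ler_pdivrMr//; apply/ltW; exact: truncnS_gt.
by move=> /le_trans; apply; apply: nneseries_lim_ge => n _; exact: f0.
Qed.

Lemma running_cost_cons S k X : is_strategy S ->
  running_cost S (path_cons k X) =
  ((S k 1%N)%:E + running_cost (tail_strategy S) X)%E.
Proof.
move=> hS; rewrite /running_cost nneseries_recl//=.
  rewrite -nneseries_addn; last by move=> n; rewrite lee_fin hS.
  by under eq_eseriesr do rewrite addn1.
by move=> n _; rewrite lee_fin hS.
Qed.

Lemma running_cost_ge0 S X : is_strategy S -> (0 <= running_cost S X)%E.
Proof. by move=> hS; apply: nneseries_ge0 => n _ _; rewrite lee_fin hS. Qed.

Lemma terminal_cons (vm vp vs : R) k X :
  terminal vm vp vs (path_cons k X) = terminal vm vp vs X.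
Proof.
rewrite /terminal (_ : `[< escapes_minus R (path_cons k X) >] = `[< escapes_minus R X >]);
  last by apply: asbool_equiv_eq; exact: escapes_minus_cons.
rewrite (_ : `[< escapes_plus R (path_cons k X) >] = `[< escapes_plus R X >])//.
by apply: asbool_equiv_eq; exact: escapes_plus_cons.
Qed.

(** Real-valued twin of [terminal], convenient for bounds, measurability and integrability. *)
Definition terminal_value (vm vp vs : R) X : R :=
  if `[< escapes_minus R X >] then vm else if `[< escapes_plus R X >] then vp else vs.

Lemma terminalE (vm vp vs : R) X :
  terminal vm vp vs X = (terminal_value vm vp vs X)%:E.
Proof. by rewrite /terminal /terminal_value; do 2 case: ifP => // _. Qed.

End Paths.

(** * Expected payoffs and their first-step equations *)

Section Expectation.
Variable R : realType.
Implicit Types (Sm Sp Sc S : strategy R) (k i : int) (u : R) (X : nat -> int).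
Local Notation mu := (@lebesgue_measure R).
Local Notation U := (`[0%R, 1%R]%classic : set R).

Lemma measure_unit : mu U = 1%:E.
Proof. by rewrite lebesgue_measure_itv/= lte_fin ltr01 oppr0 adde0. Qed.

Lemma expect_cst Sm Sp k (c : R) : expect Sm Sp k (fun=> c%:E) = c%:E.
Proof. by rewrite /expect integral_cst//= measure_unit mule1. Qed.

Lemma measurable_running_cost Sm Sp Sc k : is_strategy Sc ->
  measurable_fun setT (fun u => running_cost Sc (gameplay Sm Sp k u)).
Proof.
move=> hS; rewrite /running_cost.
apply: ge0_emeasurable_sum => [n u _ _|n _]; first by rewrite lee_fin hS.
exact: (measurable_gameplay Sm Sp k n (fun i => (Sc i n.+1)%:E)).
Qed.

Lemma measurable_escapes_minus Sm Sp k :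
  measurable [set u | escapes_minus R (gameplay Sm Sp k u)].
Proof.
have := @measurable_fun_limn_esup _ _ R setT
  (fun n u => ((gameplay Sm Sp k u n)%:~R : R)%:E)
  (fun n => @measurable_gameplay R Sm Sp k n _ _ (fun i => (i%:~R : R)%:E)).
by move=> /(_ measurableT [set -oo%E]); rewrite setTI; apply; exact: emeasurable_set1.
Qed.

Lemma measurable_escapes_plus Sm Sp k :
  measurable [set u | escapes_plus R (gameplay Sm Sp k u)].
Proof.
have := @measurable_fun_limn_esup _ _ R setT
  (fun n u => (- ((gameplay Sm Sp k u n)%:~R : R)%:E)%E)
  (fun n => @measurable_gameplay R Sm Sp k n _ _ (fun i => - (i%:~R : R)%:E)%E).
move=> /(_ measurableT [set -oo%E]); rewrite setTI.
rewrite (_ : [set u | _] =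
  (fun u => limn_esup (fun n => (- ((gameplay Sm Sp k u n)%:~R : R)%:E)%E))
    @^-1` [set -oo%E]).
  by apply; exact: emeasurable_set1.
apply/seteqP; split=> u /=; rewrite /escapes_plus /limn_einf.
  by move/eqP; rewrite eqe_oppLR => /eqP.
by move=> ->.
Qed.

Lemma measurable_terminal_value Sm Sp k (vm vp vs : R) :
  measurable_fun setT (fun u => terminal_value vm vp vs (gameplay Sm Sp k u)).
Proof.
apply: measurable_fun_ifT => //; last apply: measurable_fun_ifT => //;
  apply: (@measurable_fun_bool _ _ _ _ true); rewrite setTI.
- rewrite [X in measurable X](_ : _ = [set u | escapes_minus R (gameplay Sm Sp k u)]).
    exact: measurable_escapes_minus.
  by apply/seteqP; split=> u /=; [move/asboolP|move=> ?; exact/asboolP].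
- rewrite [X in measurable X](_ : _ = [set u | escapes_plus R (gameplay Sm Sp k u)]).
    exact: measurable_escapes_plus.
  by apply/seteqP; split=> u /=; [move/asboolP|move=> ?; exact/asboolP].
Qed.

Lemma terminal_value_bound (lo hi vm vp vs : R) X :
  lo <= vm <= hi -> lo <= vp <= hi -> lo <= vs <= hi ->
  lo <= terminal_value vm vp vs X <= hi.
Proof. by rewrite /terminal_value; do 2 case: ifP => // _. Qed.

Lemma terminal_value_bounded (vm vp vs : R) X :
  `|terminal_value vm vp vs X| <= `|vm| + `|vp| + `|vs|.
Proof.
have := normr_ge0 vm; have := normr_ge0 vp; have := normr_ge0 vs.
by rewrite /terminal_value; case: ifP => _; [lra|case: ifP => _; lra].
Qed.

Lemma bounded_integrable (f : R -> R) (K : R) : measurable_fun setT f ->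
  (forall u, `|f u| <= K) -> mu.-integrable U (EFin \o f).
Proof.
move=> mf fK; apply: measurable_bounded_integrable => //.
- by have := ltry (1 : R); rewrite -measure_unit.
- exact: measurable_funTS.
- exists K; split; first exact: num_real.
  by move=> M KM u _ /=; rewrite (le_trans (fK u))// ltW.
Qed.

Lemma terminal_integrable Sm Sp k (vm vp vs : R) :
  mu.-integrable U (fun u => terminal vm vp vs (gameplay Sm Sp k u)).
Proof.
rewrite (_ : (fun u => _) =
  EFin \o (fun u => terminal_value vm vp vs (gameplay Sm Sp k u))); last first.
  by apply/funext => u; exact: terminalE.
apply: (bounded_integrable (measurable_terminal_value Sm Sp k vm vp vs)) => u.
exact: terminal_value_bounded.
Qed.

Lemma expect_terminal_fin Sm Sp k (vm vp vs : R) :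
  expect Sm Sp k (terminal vm vp vs) \is a fin_num.
Proof. exact: integrable_fin_num (terminal_integrable _ _ _ _ _ _). Qed.

Lemma expect_terminal_ex Sm Sp k (vm vp vs : R) :
  exists x, expect Sm Sp k (terminal vm vp vs) = x%:E.
Proof.
by exists (fine (expect Sm Sp k (terminal vm vp vs))); rewrite fineK// expect_terminal_fin.
Qed.

Lemma expect_terminal_bound Sm Sp k (lo hi vm vp vs : R) :
  lo <= vm <= hi -> lo <= vp <= hi -> lo <= vs <= hi ->
  lo <= fine (expect Sm Sp k (terminal vm vp vs)) <= hi.
Proof.
move=> h1 h2 h3; rewrite -!lee_fin fineK ?expect_terminal_fin//.
have ic (c : R) : mu.-integrable U (fun=> c%:E).
  by apply: (@bounded_integrable (fun=> c) `|c|).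
rewrite -{1}(expect_cst Sm Sp k lo) -(expect_cst Sm Sp k hi).
by apply/andP; split; apply: le_integral => //; try exact: terminal_integrable;
  move=> u _; rewrite terminalE lee_fin;
  have /andP[] := terminal_value_bound (gameplay Sm Sp k u) h1 h2 h3.
Qed.

(** This covers costs of infinite expectation, for which both sides are [-oo]. *)
Lemma integral_sub_ge0 (t : R -> R) (K : R) (C : R -> \bar R) :
  measurable_fun setT t -> (forall u, `|t u| <= K) ->
  measurable_fun setT C -> (forall u, (0 <= C u)%E) ->
  (\int[mu]_(u in U) ((t u)%:E - C u) =
   \int[mu]_(u in U) (t u)%:E - \int[mu]_(u in U) C u)%E.
Proof.
move=> mt tK mC C0.
have it := bounded_integrable mt tK.
have mC' : measurable_fun U C by exact: measurable_funTS.
have mt' : measurable_fun U (EFin \o t) by apply/measurable_EFinP; exact: measurable_funTS.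
have IC0 : (0 <= \int[mu]_(u in U) C u)%E by apply: integral_ge0.
have [hC|hC] := ltP (\int[mu]_(u in U) C u)%E +oo%E.
  rewrite integralB//=; apply/integrableP; split => //.
  by under eq_integral do rewrite gee0_abs//.
have {}hC : (\int[mu]_(u in U) C u = +oo)%E by apply/eqP; rewrite -leye_eq.
set f := fun u => ((t u)%:E - C u)%E.
have mf : measurable_fun U f by exact: emeasurable_funB.
have K0 : 0 <= K by exact: le_trans (tK 0).
(* [C u <= K + f^- u], so the negative part inherits the infinite integral of [C]. *)
have hneg : (\int[mu]_(u in U) f^\- u = +oo)%E.
  have : (+oo <= \int[mu]_(u in U) (K%:E + f^\- u))%E.
    rewrite -hC; apply: ge0_le_integral => //.
    - by apply: emeasurable_funD => //; exact: measurable_funeneg.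
    - move=> u _; apply: (@le_trans _ _ (K%:E - f u)%E).
        rewrite /f; case: (C u) (C0 u) => [c| |]//= _.
        by rewrite lee_fin; have := tK u; rewrite ler_norml => /andP[_]; lra.
      by rewrite leeD2l// funenegE le_max lexx.
  rewrite leye_eq ge0_integralD//; last exact: measurable_funeneg.
  rewrite integral_cst//= measure_unit mule1.
  have : (0 <= \int[mu]_(u in U) f^\- u)%E by apply: integral_ge0.
  by case: (\int[mu]_(u in U) f^\- u)%E.
(* The positive part is at most [K], hence no indeterminate difference arises. *)
have hpos : (\int[mu]_(u in U) f^\+ u < +oo)%E.
  apply: (@le_lt_trans _ _ (\int[mu]_(u in U) (cst K%:E) u)%E).
    apply: ge0_le_integral => //; first exact: measurable_funepos.
    move=> u _ /=; rewrite funeposE ge_max lee_fin K0 andbT /f.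
    case: (C u) (C0 u) => [c| |]//= c0; last by rewrite leNye.
    rewrite lee_fin; have := tK u; rewrite ler_norml => /andP[_].
    by move: c0; rewrite lee_fin; lra.
  by rewrite integral_cst//= measure_unit mule1 ltry.
rewrite [LHS]integralE hneg hC.
have it' : (\int[mu]_(u in U) (t u)%:E)%E \is a fin_num.
  exact: integrable_fin_num it.
rewrite -(fineK it') -[X in (X - _)%E]fineK// fin_real// hpos andbT.
by rewrite (lt_le_trans (ltNyr 0))// integral_ge0.
Qed.

Lemma expect_payoff Sm Sp Sc k (vm vp vs : R) : is_strategy Sc ->
  (expect Sm Sp k (fun X => terminal vm vp vs X - running_cost Sc X) =
   expect Sm Sp k (terminal vm vp vs) - expect Sm Sp k (running_cost Sc))%E.
Proof.
move=> hS; rewrite /expect.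
under eq_integral do rewrite terminalE.
under [in X in _ = (X - _)%E]eq_integral do rewrite terminalE.
apply: (integral_sub_ge0 (K := `|vm| + `|vp| + `|vs|)).
- exact: measurable_terminal_value.
- by move=> u; exact: terminal_value_bounded.
- exact: measurable_running_cost.
- by move=> u; exact: running_cost_ge0.
Qed.

Lemma expect_ge0 Sm Sp k F : (forall X, (0 <= F X)%E) -> (0 <= expect Sm Sp k F)%E.
Proof. by move=> F0; apply: integral_ge0. Qed.

Lemma terminal_value_shift (c vm vp vs : R) X :
  terminal_value (vm + c) (vp + c) (vs + c) X = terminal_value vm vp vs X + c.
Proof. by rewrite /terminal_value; do 2 case: ifP => // _. Qed.

Lemma expect_terminal_shift Sm Sp k (c vm vp vs : R) :
  expect Sm Sp k (terminal (vm + c) (vp + c) (vs + c)) =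
  (expect Sm Sp k (terminal vm vp vs) + c%:E)%E.
Proof.
rewrite -[X in (_ + X)%E](expect_cst Sm Sp k c) /expect -integralD//=.
- by apply: eq_integral => u _; rewrite !terminalE -EFinD terminal_value_shift.
- exact: terminal_integrable.
- by apply: (@bounded_integrable (fun=> c) `|c|).
Qed.

Lemma expect_terminal_first_step Sm Sp k (vm vp vs : R) :
  is_strategy Sm -> is_strategy Sp ->
  let p := up_prob Sm Sp k 1 in
  let E' k' := fine (expect (tail_strategy Sm) (tail_strategy Sp) k'
                       (terminal vm vp vs)) in
  fine (expect Sm Sp k (terminal vm vp vs)) = p * E' (k + 1) + (1 - p) * E' (k - 1).
Proof.
move=> hm hp p E'.
(* Adding [c] makes the terminal payoff nonnegative, as [expect_first_step] requires; it cancels at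
   the end because the weights [p] and [1 - p] sum to 1. *)
pose c := `|vm| + `|vp| + `|vs|.
have h X : (0 <= terminal (vm + c) (vp + c) (vs + c) X)%E.
  rewrite terminalE lee_fin terminal_value_shift -lerBlDr sub0r.
  have := terminal_value_bounded vm vp vs X; rewrite ler_norml => /andP[? _].
  by rewrite /c.
have := expect_first_step (k := k) hm hp h; cbv zeta.
rewrite (_ : _ \o path_cons k = terminal (vm + c) (vp + c) (vs + c)); last first.
  by apply/funext => X /=; rewrite terminal_cons.
rewrite !expect_terminal_shift.
move=> /(_ _ _)/wrap[].
- move=> k'; under eq_fun do rewrite terminal_cons terminalE.
  by apply/measurable_EFinP; exact: measurable_terminal_value.
- under eq_fun do rewrite terminalE.
  by apply/measurable_EFinP; exact: measurable_terminal_value.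
have fin_ex Sm' Sp' k' := expect_terminal_ex Sm' Sp' k' vm vp vs.
have [x ex] := fin_ex Sm Sp k.
have [a ea] := fin_ex (tail_strategy Sm) (tail_strategy Sp) (k + 1).
have [b eb] := fin_ex (tail_strategy Sm) (tail_strategy Sp) (k - 1).
rewrite -/p /E' ex ea eb => -[e].
rewrite -[fine x%:E]/x -[fine a%:E]/a -[fine b%:E]/b.
by apply: (addIr c); rewrite e; ring.
Qed.

Lemma expect_cost_first_step Sm Sp Sc k :
  is_strategy Sm -> is_strategy Sp -> is_strategy Sc ->
  let p := up_prob Sm Sp k 1 in
  let E' k' := expect (tail_strategy Sm) (tail_strategy Sp) k'
                       (running_cost (tail_strategy Sc)) in
  (expect Sm Sp k (running_cost Sc) =
   (Sc k 1%N)%:E + (p%:E * E' (k + 1)%R + (1 - p)%R%:E * E' (k - 1)%R))%E.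
Proof.
move=> hm hp hc p E'.
have hE k' : (expect (tail_strategy Sm) (tail_strategy Sp) k'
    (running_cost Sc \o path_cons k) = (Sc k 1%N)%:E + E' k')%E.
  rewrite -[X in (X + _)%E](expect_cst (tail_strategy Sm) (tail_strategy Sp) k') /E' /expect.
  rewrite -ge0_integralD//=.
  - by apply: eq_integral => u _; rewrite running_cost_cons.
  - by move=> u _; rewrite lee_fin hc.
  - by move=> u _; exact: running_cost_ge0 (tail_is_strategy hc).
  - by apply: measurable_funTS; exact: measurable_running_cost (tail_is_strategy hc).
rewrite (expect_first_step hm hp); first last.
- exact: measurable_running_cost.
- move=> k'; under eq_fun do rewrite running_cost_cons//.
  apply: emeasurable_funD => //; exact: measurable_running_cost (tail_is_strategy hc).
- by move=> X; exact: running_cost_ge0.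
rewrite !hE -/p.
have p0 : 0 <= p by exact: up_prob_ge0.
have p1 : 0 <= 1 - p by rewrite subr_ge0; exact: up_prob_le1.
have E0 k' : (0 <= E' k')%E.
  by apply: expect_ge0 => X; exact: running_cost_ge0 (tail_is_strategy hc).
have c0 : 0 <= Sc k 1%N by exact: hc.
move: (E' (k + 1)) (E' (k - 1)) (E0 (k + 1)) (E0 (k - 1)) => e1 e2 e10 e20.
rewrite !ge0_muleDr ?lee_fin//.
rewrite addeACA; congr (_ + _)%E.
by rewrite -!EFinM -EFinD; congr (_%:E); ring.
Qed.

(** A finite payoff forces a finite cost. *)
Lemma EFin_sub_eq (a x : R) (c : \bar R) :
  (a%:E - c = x%:E -> c = (a - x)%R%:E)%E.
Proof. by case: c => [c| |]// [<-]; congr (_%:E); ring. Qed.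

(** Finiteness of the two continuation payoffs makes the continuation costs finite, so the
    first-step equations of the terminal part and of the cost can be subtracted in the reals. *)
Lemma expect_payoff_first_step Sm Sp Sc k (vm vp vs xu xd : R) :
  is_strategy Sm -> is_strategy Sp -> is_strategy Sc ->
  let p := up_prob Sm Sp k 1 in
  let J' k' := expect (tail_strategy Sm) (tail_strategy Sp) k'
     (fun X => terminal vm vp vs X - running_cost (tail_strategy Sc) X)%E in
  J' (k + 1) = xu%:E -> J' (k - 1) = xd%:E ->
  expect Sm Sp k (fun X => terminal vm vp vs X - running_cost Sc X)%E =
  (p * xu + (1 - p) * xd - Sc k 1%N)%:E.
Proof.
move=> hm hp hc p J'; rewrite /J' !expect_payoff//; try exact: tail_is_strategy.
rewrite (expect_cost_first_step k hm hp hc) -/p.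
have := expect_terminal_first_step k vm vp vs hm hp; cbv zeta; rewrite -/p.
have [x ->] := expect_terminal_ex Sm Sp k vm vp vs.
have [tu ->] := expect_terminal_ex (tail_strategy Sm) (tail_strategy Sp) (k + 1) vm vp vs.
have [td ->] := expect_terminal_ex (tail_strategy Sm) (tail_strategy Sp) (k - 1) vm vp vs.
rewrite -[fine x%:E]/x -[fine tu%:E]/tu -[fine td%:E]/td => ->.
move=> /EFin_sub_eq -> /EFin_sub_eq ->.
apply: (congr1 EFin (_ : p * tu + (1 - p) * td -
  (Sc k 1%N + (p * (tu - xu) + (1 - p) * (td - xd))) = _)).
by ring.
Qed.

End Expectation.

(** * Supermartingale and martingale arguments *)

Section Verification.
Variable R : realType.
Implicit Types (Sm Sp Sc S A B : strategy R) (k i : int) (u : R) (X : nat -> int).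
Implicit Types (f c : int -> R).
Local Notation mu := (@lebesgue_measure R).
Local Notation U := (`[0%R, 1%R]%classic : set R).

(* Truncated strategies make the cost up to time [n] a running cost, so that the
   first-step recursion of [running_cost] applies to it. *)
Definition truncate S (n : nat) : strategy R :=
  fun i j => if (j <= n)%N then S i j else 0.

Lemma truncate_is_strategy S n : is_strategy S -> is_strategy (truncate S n).
Proof. by move=> hS i j j0; rewrite /truncate; case: ifP => // _; exact: hS. Qed.

Lemma running_cost_truncate S n X : is_strategy S ->
  running_cost (truncate S n) X = (\sum_(0 <= t < n) (S (X t) t.+1)%:E)%E.
Proof.
move=> hS; rewrite /running_cost (@nneseries_split _ _ 0%N n); last first.
  by move=> j _; rewrite lee_fin; exact: truncate_is_strategy.
rewrite add0n eseries0 ?adde0; last first.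
  by move=> j nj _; rewrite /truncate ltnNge nj.
by apply: eq_big_nat => t /andP[_ tn]; rewrite /truncate tn.
Qed.

Lemma running_cost_truncate_cvg S X : is_strategy S ->
  running_cost (truncate S n) X @[n --> \oo] --> running_cost S X.
Proof.
move=> hS; under eq_cvg do rewrite running_cost_truncate//.
by apply: is_cvg_nneseries => n _ _; rewrite lee_fin hS.
Qed.

Lemma running_cost_truncate_nd S X : is_strategy S ->
  {homo (fun n => running_cost (truncate S n) X) : n m / (n <= m)%N >-> (n <= m)%E}.
Proof.
move=> hS; apply/nondecreasing_seqP => n; rewrite !running_cost_truncate//.
by rewrite big_nat_recr//= leeDl// lee_fin hS.
Qed.

Lemma expect_cost_cvg Sm Sp S k : is_strategy S ->
  expect Sm Sp k (running_cost (truncate S n)) @[n --> \oo] -->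
  expect Sm Sp k (running_cost S).
Proof.
move=> hS.
have -> : expect Sm Sp k (running_cost S) = (\int[mu]_(u in U)
    limn (fun n => running_cost (truncate S n) (gameplay Sm Sp k u)))%E.
  apply: eq_integral => u _.
  by apply/esym/cvg_lim => //; exact: running_cost_truncate_cvg.
apply: cvg_monotone_convergence => //.
- move=> n; apply: measurable_funTS.
  exact: measurable_running_cost (truncate_is_strategy n hS).
- by move=> n u _; exact: running_cost_ge0 (truncate_is_strategy n hS).
- by move=> u _; exact: running_cost_truncate_nd.
Qed.

Lemma expect_truncate0 Sm Sp k n :
  expect Sm Sp k (running_cost (truncate (fun _ _ => 0) n)) = 0%E.
Proof.
transitivity (expect Sm Sp k (fun=> 0%:E)); last exact: expect_cst.
by apply: eq_integral => u _; rewrite running_cost_truncate// big1.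
Qed.

Lemma expect_cost_truncate_le Sm Sp S k n : is_strategy S ->
  (expect Sm Sp k (running_cost (truncate S n)) <= expect Sm Sp k (running_cost S))%E.
Proof.
move=> hS; apply: ge0_le_integral => //.
- by move=> u _; exact: running_cost_ge0 (truncate_is_strategy n hS).
- by apply: measurable_funTS; exact: measurable_running_cost (truncate_is_strategy n hS).
- by apply: measurable_funTS; exact: measurable_running_cost.
move=> u _; rewrite running_cost_truncate//.
by apply: nneseries_lim_ge => t _; rewrite lee_fin hS.
Qed.

(* [A] is a slack: [A = 0] is the martingale case, and choosing [A] as the
   defect turns a supermartingale inequality into this identity. *)
Lemma expect_martingale n Sm Sp A B f k :
  is_strategy Sm -> is_strategy Sp -> is_strategy A -> is_strategy B ->
  (forall i, 0 <= f i) ->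
  (forall i j, (0 < j)%N -> up_prob Sm Sp i j * f (i + 1) +
     (1 - up_prob Sm Sp i j) * f (i - 1) + A i j = f i + B i j) ->
  (expect Sm Sp k (fun X => (f (X n))%:E) +
     expect Sm Sp k (running_cost (truncate A n)) =
   (f k)%:E + expect Sm Sp k (running_cost (truncate B n)))%E.
Proof.
elim: n Sm Sp A B k => [|n ih] Sm Sp A B k hm hp hA hB f0 hf.
  have e0 S : is_strategy S -> expect Sm Sp k (running_cost (truncate S 0)) = 0%:E.
    move=> hS; rewrite -(expect_cst Sm Sp k 0) /expect; apply: eq_integral => u _.
    by rewrite running_cost_truncate// big_nil.
  rewrite !e0//; congr (_ + _)%E.
  exact: (expect_cst Sm Sp k (f k)).
(* This conversion is what lets the truncation level decrease along the induction. *)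
have tE S : tail_strategy (truncate S n.+1) = truncate (tail_strategy S) n by [].
rewrite (expect_cost_first_step k hm hp (truncate_is_strategy n.+1 hA)).
rewrite (expect_cost_first_step k hm hp (truncate_is_strategy n.+1 hB)).
rewrite (expect_first_step (k := k) hm hp); first last.
- exact: (measurable_gameplay Sm Sp k n.+1 (fun i => (f i)%:E)).
- move=> k'.
  exact: (measurable_gameplay (tail_strategy Sm) (tail_strategy Sp) k' n (fun i => (f i)%:E)).
- by move=> X; rewrite lee_fin.
rewrite !tE.
have := hf k 1%N isT; set p := up_prob Sm Sp k 1.
have p0 : 0 <= p by exact: up_prob_ge0.
have p1 : 0 <= 1 - p by rewrite subr_ge0; exact: up_prob_le1.
have hm' := tail_is_strategy hm; have hp' := tail_is_strategy hp.
have hA' := tail_is_strategy hA; have hB' := tail_is_strategy hB.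
have ihk k' := ih (tail_strategy Sm) (tail_strategy Sp) (tail_strategy A) (tail_strategy B)
  k' hm' hp' hA' hB' f0 (fun i j _ => hf i j.+1 isT).
have := ihk (k - 1); have := ihk (k + 1).
have c0 S k' : is_strategy S -> (0 <= expect (tail_strategy Sm) (tail_strategy Sp) k'
    (running_cost (truncate S n)))%E.
  move=> hS; apply: expect_ge0 => X; exact: running_cost_ge0 (truncate_is_strategy n hS).
have e0 k' : (0 <= expect (tail_strategy Sm) (tail_strategy Sp) k'
    ((fun X : nat -> int => (f (X n.+1))%:E) \o path_cons k))%E.
  by apply: expect_ge0 => X; rewrite lee_fin.
have eE k' : expect (tail_strategy Sm) (tail_strategy Sp) k'
    (fun X : nat -> int => (f (X n))%:E) = expect (tail_strategy Sm) (tail_strategy Sp) k'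
    ((fun X : nat -> int => (f (X n.+1))%:E) \o path_cons k) by [].
rewrite !eE.
move: (e0 (k + 1)) (e0 (k - 1)) (c0 _ (k + 1) hA') (c0 _ (k - 1) hA')
  (c0 _ (k + 1) hB') (c0 _ (k - 1) hB').
move: (expect _ _ (k + 1) (_ \o _)) (expect _ _ (k - 1) (_ \o _)) => e1 e2.
move: (expect (tail_strategy Sm) (tail_strategy Sp) (k + 1)
    (running_cost (truncate (tail_strategy A) n)))
  (expect (tail_strategy Sm) (tail_strategy Sp) (k - 1)
    (running_cost (truncate (tail_strategy A) n)))
  (expect (tail_strategy Sm) (tail_strategy Sp) (k + 1)
    (running_cost (truncate (tail_strategy B) n)))
  (expect (tail_strategy Sm) (tail_strategy Sp) (k - 1)
    (running_cost (truncate (tail_strategy B) n))) => a1 a2 b1 b2.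
rewrite {1}/truncate {1}/truncate/=.
move: (hA k 1%N isT) (hB k 1%N isT) (f0 (k + 1)) (f0 (k - 1)) (f0 k).
move: (A k 1%N) (B k 1%N) (f (k + 1)) (f (k - 1)) (f k) => a b fu fd fk.
move=> ha hb hfu hfd hfk he1 he2 ha1 ha2 hb1 hb2 hu hd hk.
(* The expectations may be infinite, so the terms are regrouped by first step using distributivity
   over nonnegative summands only. *)
transitivity (p%:E * (e1 + a1) + (1 - p)%:E * (e2 + a2) + a%:E)%E.
  rewrite !ge0_muleDr ?lee_fin// [(a%:E + _)%E]addeC addeA; congr (_ + _)%E.
  by rewrite addeACA.
have hk' : (p%:E * fu%:E + (1 - p)%R%:E * fd%:E + a%:E = fk%:E + b%:E)%E.
  exact: (congr1 EFin hk).
rewrite hu hd !ge0_muleDr ?lee_fin//.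
by rewrite [X in (X + _)%E = _]addeACA [LHS]addeAC [RHS]addeA -hk'.
Qed.

Lemma cvg_escapes_plus f (l : R) X : lim_pinfty f l -> escapes_plus R X ->
  f (X n) @[n --> \oo] --> l.
Proof.
move=> fl /escapes_plusP hX; apply/cvgrPdist_lt => e e0.
have /cvgrPdist_lt/(_ e e0)[N _ hN] := fl.
have [M hM] := hX N%:Z; exists M => //= n /hM Xn.
have -> : X n = `|X n|%N%:Z by lia.
by apply: hN => /=; lia.
Qed.

Lemma cvg_escapes_minus f (l : R) X : lim_minfty f l -> escapes_minus R X ->
  f (X n) @[n --> \oo] --> l.
Proof.
move=> fl /escapes_minusP hX; apply/cvgrPdist_lt => e e0.
have /cvgrPdist_lt/(_ e e0)[N _ hN] := fl.
have [M hM] := hX (- N%:Z); exists M => //= n /hM Xn.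
have -> : X n = - `|X n|%N%:Z by lia.
by apply: hN => /=; lia.
Qed.

Lemma terminal_le_liminf f (lm lp vm vp vs : R) X :
  lim_minfty f lm -> lim_pinfty f lp -> vm <= lm -> vp <= lp ->
  (forall i, vs <= f i) ->
  (terminal vm vp vs X <= limn_einf (fun n => (f (X n))%:E))%E.
Proof.
move=> flm flp vml vpl vsf; rewrite /terminal.
case: ifPn => [/asboolP hX|_].
  have h : (f (X n))%:E @[n --> \oo] --> lm%:E.
    by apply: cvg_EFin; [exact: nearW|exact: cvg_escapes_minus].
  by rewrite (cvg_limn_einf_sup h).1 lee_fin.
case: ifPn => [/asboolP hX|_].
  have h : (f (X n))%:E @[n --> \oo] --> lp%:E.
    by apply: cvg_EFin; [exact: nearW|exact: cvg_escapes_plus].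
  by rewrite (cvg_limn_einf_sup h).1 lee_fin.
rewrite limn_einf_lim; apply: lime_ge; first exact: is_cvg_einfs.
by apply: nearW => n; apply: le_ereal_inf_tmp => _ [m _ <-]; rewrite lee_fin.
Qed.

Lemma expect_terminal_le Sm Sp k (vm vp vs vm' vp' vs' : R) :
  vm <= vm' -> vp <= vp' -> vs <= vs' ->
  (expect Sm Sp k (terminal vm vp vs) <= expect Sm Sp k (terminal vm' vp' vs'))%E.
Proof.
move=> h1 h2 h3; apply: le_integral => //; try exact: terminal_integrable.
move=> u _; rewrite !terminalE lee_fin /terminal_value.
by case: ifP => // _; case: ifP.
Qed.

(** Terminal payoffs are below the lower limit of [f] along the path, Fatou's lemma bounds its
    expectation, and [expect_martingale] bounds each [f (X n)] in mean. *)
Lemma supermartingale_bound Sm Sp Sc f k (lm lp vm vp vs : R) :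
  is_strategy Sm -> is_strategy Sp -> is_strategy Sc ->
  (forall i, 0 <= f i) -> lim_minfty f lm -> lim_pinfty f lp ->
  vm <= lm -> vp <= lp -> (forall i, vs <= f i) ->
  (forall i j, (0 < j)%N -> up_prob Sm Sp i j * f (i + 1) +
     (1 - up_prob Sm Sp i j) * f (i - 1) <= f i + Sc i j) ->
  (expect Sm Sp k (terminal vm vp vs) <=
   (f k)%:E + expect Sm Sp k (running_cost Sc))%E.
Proof.
move=> hm hp hc f0 flm flp vml vpl vsf hf.
have lm0 : 0 <= lm by apply: (cvgr_to_ge flm); exact: nearW.
have lp0 : 0 <= lp by apply: (cvgr_to_ge flp); exact: nearW.
pose A : strategy R := fun i j => f i + Sc i j - (up_prob Sm Sp i j * f (i + 1) +
     (1 - up_prob Sm Sp i j) * f (i - 1)).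
have hA : is_strategy A by move=> i j j0; rewrite subr_ge0 hf.
have hn n : (expect Sm Sp k (fun X => (f (X n))%:E) <=
    (f k)%:E + expect Sm Sp k (running_cost Sc))%E.
  apply: (@le_trans _ _ ((f k)%:E + expect Sm Sp k (running_cost (truncate Sc n)))%E);
    last by rewrite leeD2l// expect_cost_truncate_le.
  rewrite -(@expect_martingale n Sm Sp A Sc f k)//; last first.
    by move=> i j j0; rewrite /A addrC subrK.
  rewrite leeDl//; apply: expect_ge0 => X.
  exact: running_cost_ge0 (truncate_is_strategy n hA).
(* Positive parts make the terminal payoff nonnegative; they remain below the limits and values of
   [f] because [f >= 0]. *)
have := expect_terminal_le Sm Sp k (vm' := Num.max vm 0) (vp' := Num.max vp 0)
  (vs' := Num.max vs 0).
move=> /(_ vm vp vs); rewrite !le_max !lexx => /(_ isT isT isT)/le_trans; apply.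
apply: (@le_trans _ _ (\int[mu]_(u in U) limn_einf (fun n => (f (gameplay Sm Sp k u n))%:E))%E).
  apply: ge0_le_integral => //.
  - move=> u _; rewrite terminalE lee_fin.
    rewrite /terminal_value; case: ifP => _; first by rewrite le_max lexx orbT.
    by case: ifP => _; rewrite le_max lexx orbT.
  - by have /integrableP[] := terminal_integrable Sm Sp k (Num.max vm 0)
      (Num.max vp 0) (Num.max vs 0).
  - apply: measurable_funTS; rewrite /limn_einf.
    apply: measurableT_comp => //; apply: measurable_fun_limn_esup => n.
    exact: (measurable_gameplay Sm Sp k n (fun i => (- (f i)%:E)%E)).
  - move=> u _; apply: (terminal_le_liminf _ flm flp); rewrite ?ge_max ?vml ?vpl//.
    by move=> i; rewrite ge_max vsf f0.
apply: (@le_trans _ _ (limn_einf (fun n => expect Sm Sp k (fun X => (f (X n))%:E)))%E).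
  apply: fatou => //.
  - move=> n; apply: measurable_funTS.
    exact: (measurable_gameplay Sm Sp k n (fun i => (f i)%:E)).
  - by move=> n u _; rewrite lee_fin.
rewrite limn_einf_lim; apply: lime_le; first exact: is_cvg_einfs.
by apply: nearW => n; apply: le_trans (hn n); apply: ereal_inf_lbound; exists n => /=.
Qed.

Definition escapes_ae Sm Sp k :=
  {ae mu, forall u, U u -> escapes_minus R (gameplay Sm Sp k u) \/
                           escapes_plus R (gameplay Sm Sp k u)}.

(** A cost of finite expectation is almost surely finite, whereas a path that does not escape visits
    some site [i] infinitely often and pays at least [c i] each time. *)
Lemma finite_cost_escapes Sm Sp Sc k c : is_strategy Sc ->
  (forall i, 0 < c i) -> (forall i j, (0 < j)%N -> c i <= Sc i j) ->
  (expect Sm Sp k (running_cost Sc) < +oo)%E -> escapes_ae Sm Sp k.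
Proof.
move=> hc c0 cS hfin.
have ic : mu.-integrable U (fun u => running_cost Sc (gameplay Sm Sp k u)).
  apply/integrableP; split.
    by apply: measurable_funTS; exact: measurable_running_cost.
  by under eq_integral do rewrite gee0_abs ?running_cost_ge0//.
apply: filterS (integrable_ae _ ic) => // u hu Uu.
have [|hm] := pselect (escapes_minus R (gameplay Sm Sp k u)); first by left.
have [|hp] := pselect (escapes_plus R (gameplay Sm Sp k u)); first by right.
have [i hi] := not_escapes_visited (gameplay_nearest_neighbour Sm Sp k u) hm hp.
by have := hu Uu; rewrite (running_cost_visited hc (c0 i) (cS i) hi).
Qed.

(** Dominated convergence with the bound [K]; the value [vs] is taken on a null event only. *)
Lemma martingale_cvg Sm Sp f k (K lm lp vs : R) : (forall i, 0 <= f i <= K) ->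
  lim_minfty f lm -> lim_pinfty f lp -> escapes_ae Sm Sp k ->
  expect Sm Sp k (fun X => (f (X n))%:E) @[n --> \oo] -->
  expect Sm Sp k (terminal lm lp vs).
Proof.
move=> fK flm flp hesc.
have [] := @dominated_convergence _ _ R mu U (measurable_itv _)
  (fun n u => (f (gameplay Sm Sp k u n))%:E)
  (fun u => terminal lm lp vs (gameplay Sm Sp k u)) (cst K%:E) => //.
- move=> n; apply: measurable_funTS.
  exact: (measurable_gameplay Sm Sp k n (fun i => (f i)%:E)).
- by have /integrableP[] := terminal_integrable Sm Sp k lm lp vs.
- apply: (@filterS _ _ (ae_filter_ringOfSetsType mu) _ _ _ hesc) => u hu Uu.
  have h : f (gameplay Sm Sp k u n) @[n --> \oo] -->
      terminal_value lm lp vs (gameplay Sm Sp k u).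
    rewrite /terminal_value; case: ifPn => [/asboolP|/asboolP hm].
      exact: cvg_escapes_minus.
    by case: (hu Uu) => // hp; rewrite asboolT//; exact: cvg_escapes_plus.
  have h' : (f (gameplay Sm Sp k u n))%:E @[n --> \oo] -->
      (terminal_value lm lp vs (gameplay Sm Sp k u))%:E.
    by apply: cvg_EFin; [exact: nearW|exact: h].
  by rewrite terminalE; exact: h'.
- by apply: (@bounded_integrable R (fun=> K) `|K|).
- apply: nearW => u n _; rewrite lee_fin; have /andP[h1 h2] := fK (gameplay Sm Sp k u n).
  by rewrite ger0_norm.
Qed.

(** The zero-slack identity of [expect_martingale], passed to the limit on both sides. *)
Lemma martingale_value Sm Sp Sc f k (K lm lp vs : R) :
  is_strategy Sm -> is_strategy Sp -> is_strategy Sc ->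
  (forall i, 0 <= f i <= K) -> lim_minfty f lm -> lim_pinfty f lp ->
  (forall i j, (0 < j)%N -> up_prob Sm Sp i j * f (i + 1) +
     (1 - up_prob Sm Sp i j) * f (i - 1) = f i + Sc i j) ->
  escapes_ae Sm Sp k ->
  (expect Sm Sp k (terminal lm lp vs) = (f k)%:E + expect Sm Sp k (running_cost Sc))%E.
Proof.
move=> hm hp hc fK flm flp hf hesc.
have f0 i : 0 <= f i by have /andP[] := fK i.
pose Z : strategy R := fun _ _ => 0.
have hZ : is_strategy Z by [].
have hn n : (expect Sm Sp k (fun X => (f (X n))%:E) =
    (f k)%:E + expect Sm Sp k (running_cost (truncate Sc n)))%E.
  rewrite -(@expect_martingale n Sm Sp Z Sc f k)//; last first.
    by move=> i j j0; rewrite addr0 hf.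
  by rewrite expect_truncate0 adde0.
have h1 := @martingale_cvg Sm Sp f k K lm lp vs fK flm flp hesc.
have h2 := @expect_cost_cvg Sm Sp Sc k hc.
have h3 : ((f k)%:E + expect Sm Sp k (running_cost (truncate Sc n)))%E @[n --> \oo] -->
  ((f k)%:E + expect Sm Sp k (running_cost Sc))%E.
  by apply: cvgeD => //; exact: cvg_cst.
apply: (cvg_unique _ h1); first exact: ereal_hausdorff.
by rewrite (funext hn).
Qed.

(** The mean cost up to time [n] is the increase of the mean of [f (X n)], hence at most [K] for all
    [n]. *)
Lemma bounded_cost_escapes Sm Sp Sc f c k (K : R) :
  is_strategy Sm -> is_strategy Sp -> is_strategy Sc ->
  (forall i, 0 <= f i <= K) ->
  (forall i, 0 < c i) -> (forall i j, (0 < j)%N -> c i <= Sc i j) ->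
  (forall i j, (0 < j)%N -> up_prob Sm Sp i j * f (i + 1) +
     (1 - up_prob Sm Sp i j) * f (i - 1) = f i + Sc i j) ->
  escapes_ae Sm Sp k.
Proof.
move=> hm hp hc fK c0 cS hf.
have f0 i : 0 <= f i by have /andP[] := fK i.
pose Z : strategy R := fun _ _ => 0.
have hZ : is_strategy Z by [].
apply: (finite_cost_escapes hc c0 cS).
apply: (@le_lt_trans _ _ K%:E); last exact: ltry.
have h2 := @expect_cost_cvg Sm Sp Sc k hc.
rewrite -(cvg_lim _ h2)//; apply: lime_le.
  by apply/cvg_ex; exists (expect Sm Sp k (running_cost Sc)).
apply: nearW => n.
apply: (@le_trans _ _ ((f k)%:E + expect Sm Sp k (running_cost (truncate Sc n)))%E).
  by rewrite leeDr// lee_fin.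
rewrite -(@expect_martingale n Sm Sp Z Sc f k)//; last first.
  by move=> i j j0; rewrite addr0 hf.
rewrite expect_truncate0 adde0.
rewrite -(expect_cst Sm Sp k K); apply: ge0_le_integral => //.
- by move=> u _; rewrite lee_fin.
- apply: measurable_funTS; exact: (measurable_gameplay Sm Sp k n (fun i => (f i)%:E)).
- by move=> u _; rewrite lee_fin; have /andP[] := fK (gameplay Sm Sp k u n).
Qed.

End Verification.

(** * The one-turn game at a single site *)

Section SiteAlgebra.
Variable R : realType.
Implicit Types (a b c mu md nu nd : R).

(** The last two equations on the left give the total gaps [mu - md] and [nd - nu]; the first two
    say how [m0] and [n0] divide them. *)
Lemma ABMN_site a b (m0 : R) mu md (n0 : R) nu nd : 0 < a -> 0 < b ->
  [/\ (a + b) * (m0 + a) = a * mu + b * md, (a + b) * (n0 + b) = a * nu + b * nd,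
      (a + b) ^+ 2 = b * (mu - md) & (a + b) ^+ 2 = a * (nd - nu)] <->
  [/\ mu - m0 = 2 * a + b, m0 - md = a ^+ 2 / b,
      nd - n0 = 2 * b + a & n0 - nu = b ^+ 2 / a].
Proof.
move=> a0 b0; have ab0 : 0 < a + b by rewrite addr_gt0.
have a0' : a != 0 by rewrite gt_eqF. have b0' : b != 0 by rewrite gt_eqF.
have ab0' : a + b != 0 by rewrite gt_eqF.
split=> [[e1 e2 e3 e4]|[e1 e2 e3 e4]].
- have eM : mu - md = (a + b) ^+ 2 / b by rewrite e3; field.
  have eN : nd - nu = (a + b) ^+ 2 / a by rewrite e4; field.
  have h2 : m0 - md = a ^+ 2 / b.
    apply: (mulfI ab0'); rewrite (_ : _ * (m0 - md) = a * (mu - md) - (a + b) * a).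
      by rewrite eM; field.
    by move: e1; lra.
  have h4 : n0 - nu = b ^+ 2 / a.
    apply: (mulfI ab0'); rewrite (_ : _ * (n0 - nu) = b * (nd - nu) - (a + b) * b).
      by rewrite eN; field.
    by move: e2; lra.
  split=> //.
    rewrite (_ : mu - m0 = (mu - md) - (m0 - md)); last by ring.
    by rewrite eM h2; field.
  rewrite (_ : nd - n0 = (nd - nu) - (n0 - nu)); last by ring.
  by rewrite eN h4; field.
- have -> : mu = m0 + (2 * a + b) by rewrite -e1; ring.
  have -> : md = m0 - a ^+ 2 / b by rewrite -e2; ring.
  have -> : nd = n0 + (2 * b + a) by rewrite -e3; ring.
  have -> : nu = n0 - b ^+ 2 / a by rewrite -e4; ring.
  by split; field.
Qed.

(** The up-probability at one site, with [b] Mina's stake and [c] Maxine's. *)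
Definition share b c : R := if b + c == 0 then 1 / 2 else c / (b + c).

Lemma share_pos b c : 0 < b + c -> share b c = c / (b + c).
Proof. by move=> h; rewrite /share gt_eqF. Qed.

(* The gap between the two sides is [(c - a)^2 / (b + c)]. *)
Lemma best_response a b (m0 : R) mu md c : 0 < a -> 0 < b -> 0 <= c ->
  mu - m0 = 2 * a + b -> m0 - md = a ^+ 2 / b ->
  c / (b + c) * mu + b / (b + c) * md <= m0 + c.
Proof.
move=> a0 b0 c0 e1 e2.
have bc0 : 0 < b + c by rewrite ltr_pwDl.
have -> : mu = m0 + (2 * a + b) by rewrite -e1; ring.
have -> : md = m0 - a ^+ 2 / b by rewrite -e2; ring.
rewrite -subr_ge0.
rewrite (_ : _ - _ = (c - a) ^+ 2 / (b + c)).
  by rewrite divr_ge0 ?sqr_ge0// ltW.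
by field; rewrite !gt_eqF.
Qed.

(** A derivative-free first-order condition. The equilibrium equation eliminates [m0], and the loss
    from playing [c] instead of [a] factors with the two roots [a] and [M * b / (b + a) - b] in [c].
    Since it never becomes negative on [c >= 0], the roots coincide. *)
Lemma best_response_foc a b (m0 : R) mu md : 0 < a -> 0 < b ->
  a / (b + a) * mu + b / (b + a) * md = m0 + a ->
  (forall c, 0 <= c -> c / (b + c) * mu + b / (b + c) * md <= m0 + c) ->
  mu - m0 = 2 * a + b /\ m0 - md = a ^+ 2 / b.
Proof.
move=> a0 b0 e h.
have ab0 : 0 < b + a by rewrite addr_gt0.
pose M := mu - md.
have em : m0 - md = a / (b + a) * M - a.
  rewrite (_ : m0 = m0 + a - a); last by ring.
  by rewrite -e /M; field; rewrite gt_eqF.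
have key c : 0 <= c -> 0 <= (a - c) * (M * b - (b + a) * (b + c)).
  move=> c0; have bc0 : 0 < b + c by rewrite ltr_pwDl.
  have := h c c0; rewrite -subr_ge0.
  rewrite (_ : _ - _ = (a - c) * (M * b - (b + a) * (b + c)) / ((b + a) * (b + c))).
    by rewrite pmulr_lge0// invr_gt0 mulr_gt0.
  rewrite (_ : m0 = a / (b + a) * M - a + md); last by rewrite -em; ring.
  by rewrite /M; field; rewrite !gt_eqF.
have eM : M * b = (b + a) ^+ 2.
  apply/eqP; rewrite eq_le; apply/andP; split; rewrite leNgt; apply/negP => lt.
    (* The midpoint of the two roots gives the factors opposite signs. *)
    pose c := (a + (M * b / (b + a) - b)) / 2.
    have h1 : a < M * b / (b + a) - b by rewrite ltrBrDl ltr_pdivlMr// -expr2.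
    have ac : a < c by rewrite /c; lra.
    have cM : c < M * b / (b + a) - b by rewrite /c; lra.
    have := key c (ltW (lt_trans a0 ac)).
    rewrite nmulr_rge0 ?subr_lt0// subr_le0 leNgt => /negP; apply.
    by rewrite mulrC -ltr_pdivlMr// -ltrBrDl.
  (* The other root now lies below [a]; it is cut off at 0 so that [c] is an admissible stake. *)
  pose c := (a + Num.max 0 (M * b / (b + a) - b)) / 2.
  have h1 : Num.max 0 (M * b / (b + a) - b) < a.
    by rewrite gt_max a0 ltrBlDl ltr_pdivrMr// -expr2.
  have h2 : 0 <= Num.max 0 (M * b / (b + a) - b) by rewrite le_max lexx.
  have h3 : M * b / (b + a) - b <= Num.max 0 (M * b / (b + a) - b).
    by rewrite le_max lexx orbT.
  have ca : c < a by rewrite /c; lra.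
  have Mc : M * b / (b + a) - b < c by rewrite /c; lra.
  have c0 : 0 <= c by rewrite /c; lra.
  have := key c c0.
  rewrite pmulr_rge0 ?subr_gt0// subr_ge0 leNgt => /negP; apply.
  by rewrite [ltRHS]mulrC -ltr_pdivrMr// -ltrBlDl.
have eM' : M = (b + a) ^+ 2 / b by rewrite -eM; field; rewrite gt_eqF.
have e2 : m0 - md = a ^+ 2 / b by rewrite em eM'; field; rewrite !gt_eqF.
split=> //; rewrite (_ : mu - m0 = M - (m0 - md)); last by rewrite /M; ring.
by rewrite e2 eM'; field; rewrite gt_eqF.
Qed.

(** Against a zero stake any positive stake wins the turn surely. If both stakes vanish, tiny
    deviations give [mu <= m0] and [nd <= n0], and averaging gives the other inequalities. A single
    positive stake could be halved with no loss of probability. If both are positive, the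
    first-order conditions apply. *)
Lemma equilibrium_site a b (m0 : R) mu md (n0 : R) nu nd : 0 <= a -> 0 <= b ->
  m0 = share b a * mu + (1 - share b a) * md - a ->
  n0 = share b a * nu + (1 - share b a) * nd - b ->
  (forall c, 0 <= c -> share b c * mu + (1 - share b c) * md - c <= m0) ->
  (forall c, 0 <= c -> share c a * nu + (1 - share c a) * nd - c <= n0) ->
  [/\ a = 0, b = 0, mu <= m0 <= md & nd <= n0 <= nu] \/
  [/\ 0 < a, 0 < b, mu - m0 = 2 * a + b /\ m0 - md = a ^+ 2 / b &
      nd - n0 = 2 * b + a /\ n0 - nu = b ^+ 2 / a].
Proof.
have share0l c : 0 < c -> share 0 c = 1.
  by move=> c0; rewrite share_pos add0r// divff// gt_eqF.
have share0r c : 0 < c -> share c 0 = 0 by move=> c0; rewrite share_pos ?addr0// mul0r.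
rewrite !le_eqVlt => /predU1P[<-|a0] /predU1P[<-|b0] hm hn dm dn.
- left; have s00 : share 0 0 = 1 / 2 by rewrite /share addr0 eqxx.
  rewrite s00 in hm hn.
  have h1 : mu <= m0.
    apply/ler_addgt0Pr => e e0; have := dm e (ltW e0); rewrite share0l//; lra.
  have h2 : nd <= n0.
    apply/ler_addgt0Pr => e e0; have := dn e (ltW e0); rewrite share0r//; lra.
  split=> //; lra.
- have b2 : 0 < b / 2 by rewrite divr_gt0.
  have := dn (b / 2) (ltW b2); rewrite !share0r// in hn *; lra.
- have a2 : 0 < a / 2 by rewrite divr_gt0.
  have := dm (a / 2) (ltW a2); rewrite !share0l// in hm *; lra.
- right.
  have ab0 : 0 < b + a by rewrite addr_gt0.
  have compl b' c : 0 < b' + c -> 1 - c / (b' + c) = b' / (b' + c).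
    by move=> h; field; rewrite gt_eqF.
  split=> //.
    apply: best_response_foc => //.
      by rewrite hm share_pos// compl//; ring.
    move=> c c0; have bc0 : 0 < b + c by rewrite ltr_pwDl.
    by have := dm c c0; rewrite share_pos// compl// lerBlDr.
  (* The same condition for Mina, with the players and the directions exchanged. *)
  apply: best_response_foc => //.
    by rewrite hn share_pos// compl// [a + b]addrC; ring.
  move=> c c0; have ac0 : 0 < c + a by rewrite ltr_wpDl.
  have := dn c c0; rewrite share_pos// compl// lerBlDr [a + c]addrC.
  by move=> h; rewrite [leLHS]addrC.
Qed.

End SiteAlgebra.

(** * From a solution of the gap equations to an equilibrium *)

Section Equilibrium.
Variable R : realType.
Implicit Types (Sm Sp Sc S : strategy R) (k i : int) (u : R) (X : nat -> int).
Implicit Types (a b m n f : int -> R).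
Local Notation mu := (@lebesgue_measure R).
Local Notation U := (`[0%R, 1%R]%classic : set R).

Definition const_strategy f : strategy R := fun i _ => f i.

Lemma const_strategyE f i j : const_strategy f i j = f i.
Proof. by []. Qed.

Lemma nondecreasing_int f : (forall i, f i <= f (i + 1)) ->
  forall i j, i <= j -> f i <= f j.
Proof.
move=> h i j ij; have -> : j = i + `|j - i|%N%:Z by lia.
elim: `|j - i|%N => [|d ih]; first by rewrite addr0.
apply: le_trans ih _; have -> : i + d.+1%:Z = i + d%:Z + 1 by lia.
exact: h.
Qed.

Lemma nondecreasing_int_le_lim f (l : R) : (forall i, f i <= f (i + 1)) ->
  lim_pinfty f l -> forall i, f i <= l.
Proof.
move=> h hl i; apply: (cvgr_to_ge hl); exists `|i|%N => //= j ij.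
by apply: nondecreasing_int => //; move: ij => /=; lia.
Qed.

Lemma nondecreasing_int_ge_lim f (l : R) : (forall i, f i <= f (i + 1)) ->
  lim_minfty f l -> forall i, l <= f i.
Proof.
move=> h hl i; apply: (cvgr_to_le hl); exists `|i|%N => //= j ij.
by apply: nondecreasing_int => //; move: ij => /=; lia.
Qed.

Lemma lim_pinftyN f (l : R) : lim_pinfty f l -> lim_pinfty (fun i => - f i) (- l).
Proof. by move=> h; apply: cvgN. Qed.

Lemma lim_minftyN f (l : R) : lim_minfty f l -> lim_minfty (fun i => - f i) (- l).
Proof. by move=> h; apply: cvgN. Qed.

Definition site_gaps a b m n := forall i,
  [/\ 0 < a i /\ 0 < b i,
      m (i + 1) - m i = 2 * a i + b i, m i - m (i - 1) = a i ^+ 2 / b i,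
      n (i - 1) - n i = 2 * b i + a i & n i - n (i + 1) = b i ^+ 2 / a i].

Lemma positive_ABMN_gaps a b m n : positive_ABMN a b m n <-> site_gaps a b m n.
Proof.
split=> [[h p] i|h].
  have [a0 b0] := p i; have [_ e1 e2 e3 e4] := h i.
  by have [|] := (ABMN_site (m i) (m (i + 1)) (m (i - 1)) (n i) (n (i + 1)) (n (i - 1)) a0 b0).1.
split=> i; have [[a0 b0] e1 e2 e3 e4] := h i; last by [].
have [|] := (ABMN_site (m i) (m (i + 1)) (m (i - 1)) (n i) (n (i + 1)) (n (i - 1)) a0 b0).2.
  by [].
by split=> //; rewrite !ltW.
Qed.

Lemma gaps_m_lt a b m n : site_gaps a b m n -> forall i, m i < m (i + 1).
Proof. by move=> h i; have [[a0 b0] e _ _ _] := h i; rewrite -subr_gt0 e; lra. Qed.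

Lemma gaps_n_lt a b m n : site_gaps a b m n -> forall i, n (i + 1) < n i.
Proof.
by move=> h i; have [[a0 b0] _ _ _ e] := h i; rewrite -subr_gt0 e divr_gt0// exprn_gt0.
Qed.

Lemma up_prob_share Sm Sp i j : up_prob Sm Sp i j = share (Sm i j) (Sp i j).
Proof. by []. Qed.

Lemma payoff_le_of (t f : R) (c : \bar R) : (0 <= c)%E -> (t%:E <= f%:E + c)%E ->
  (t%:E - c <= f%:E)%E.
Proof. by case: c => [c| |]//= _; rewrite ?lee_fin ?leNye//; lra. Qed.

Lemma share_compl (b c : R) : 0 < b + c -> 1 - share b c = b / (b + c).
Proof. by move=> h; rewrite share_pos//; field; rewrite gt_eqF. Qed.

Lemma nash_of_gaps a b m n (x mst nst : R) :
  site_gaps a b m n -> lim_minfty m 0 -> lim_pinfty m 1 ->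
  lim_minfty n x -> lim_pinfty n 0 -> mst <= 0 -> nst <= 0 ->
  nash_equilibrium 0 1 x 0 mst nst (const_strategy b) (const_strategy a).
Proof.
move=> h mm mp nm np mst0 nst0.
have a0 i : 0 < a i by have [[]] := h i.
have b0 i : 0 < b i by have [[]] := h i.
have ha : is_strategy (const_strategy a) by move=> i j _; rewrite ltW// a0.
have hb : is_strategy (const_strategy b) by move=> i j _; rewrite ltW// b0.
have mnd i : m i <= m (i + 1) by rewrite ltW// (gaps_m_lt h).
have nnd i : - n i <= - n (i + 1) by rewrite lerN2 ltW// (gaps_n_lt h).
have m01 i : 0 <= m i <= 1.
  by rewrite (nondecreasing_int_ge_lim mnd mm) (nondecreasing_int_le_lim mnd mp).
have n0x i : 0 <= n i <= x.
  have := nondecreasing_int_ge_lim nnd (lim_minftyN nm) i.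
  have := nondecreasing_int_le_lim nnd (lim_pinftyN np) i.
  by rewrite oppr0 oppr_le0 lerN2 => -> ->.
have m0 i : 0 <= m i by have /andP[] := m01 i.
have n0 i : 0 <= n i by have /andP[] := n0x i.
(* Against [b], every stake of Maxine makes [m] minus cost a supermartingale; [devn] is the
   counterpart for Mina. *)
have devm S i j : is_strategy S -> (0 < j)%N ->
    up_prob (const_strategy b) S i j * m (i + 1) +
    (1 - up_prob (const_strategy b) S i j) * m (i - 1) <= m i + S i j.
  move=> hS j0; have [_ e1 e2 _ _] := h i.
  have s0 : 0 < b i + S i j by rewrite ltr_pwDl// hS.
  rewrite up_prob_share const_strategyE share_compl// share_pos//.
  by apply: (@best_response _ (a i)) => //; exact: hS.
have devn S i j : is_strategy S -> (0 < j)%N ->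
    up_prob S (const_strategy a) i j * n (i + 1) +
    (1 - up_prob S (const_strategy a) i j) * n (i - 1) <= n i + S i j.
  move=> hS j0; have [_ _ _ e1 e2] := h i.
  have s0 : 0 < S i j + a i by rewrite ltr_wpDl// hS.
  rewrite up_prob_share const_strategyE share_compl// share_pos//.
  rewrite addrC [S i j + a i]addrC.
  by apply: (@best_response _ (b i)) => //; exact: hS.
(* With the stakes [a] and [b] themselves, the inequality becomes an equality. *)
have em i j : (0 < j)%N ->
    up_prob (const_strategy b) (const_strategy a) i j * m (i + 1) +
    (1 - up_prob (const_strategy b) (const_strategy a) i j) * m (i - 1) =
    m i + const_strategy a i j.
  move=> _; have [_ e1 e2 _ _] := h i.
  have s0 : 0 < b i + a i by rewrite addr_gt0.
  rewrite up_prob_share /const_strategy share_compl// share_pos//.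
  have -> : m (i + 1) = m i + (2 * a i + b i) by rewrite -e1; ring.
  have -> : m (i - 1) = m i - a i ^+ 2 / b i by rewrite -e2; ring.
  by field; rewrite !gt_eqF.
have en i j : (0 < j)%N ->
    up_prob (const_strategy b) (const_strategy a) i j * n (i + 1) +
    (1 - up_prob (const_strategy b) (const_strategy a) i j) * n (i - 1) =
    n i + const_strategy b i j.
  move=> _; have [_ _ _ e1 e2] := h i.
  have s0 : 0 < b i + a i by rewrite addr_gt0.
  rewrite up_prob_share /const_strategy share_compl// share_pos//.
  have -> : n (i + 1) = n i - b i ^+ 2 / a i by rewrite -e2; ring.
  have -> : n (i - 1) = n i + (2 * b i + a i) by rewrite -e1; ring.
  by field; rewrite !gt_eqF.
(* Maxine's bounded martingale and positive stakes suffice for escape. *)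
have esc k : escapes_ae (const_strategy b) (const_strategy a) k.
  have ca i j : (0 < j)%N -> a i <= const_strategy a i j by [].
  exact: (bounded_cost_escapes k hb ha ha m01 a0 ca em).
split=> //; split=> // S hS k; split.
- have -> : exp_payoff_plus 0 1 mst (const_strategy b) (const_strategy a) k = (m k)%:E.
    transitivity (expect (const_strategy b) (const_strategy a) k
      (fun X => terminal 0 1 mst X - running_cost (const_strategy a) X)%E); first by [].
    rewrite expect_payoff//.
    have := martingale_value mst hb ha ha m01 mm mp em (esc k).
    have [t ->] := expect_terminal_ex (const_strategy b) (const_strategy a) k 0 1 mst.
    have : (0 <= expect (const_strategy b) (const_strategy a) k
      (running_cost (const_strategy a)))%E.
      by apply: expect_ge0 => X; exact: running_cost_ge0.
    move: (expect _ _ k (running_cost _)) => [c| |]// _ [->].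
    by apply: (congr1 EFin (_ : m k + c - c = _)); ring.
  rewrite (_ : exp_payoff_plus _ _ _ _ _ _ = expect (const_strategy b) S k
      (fun X => terminal 0 1 mst X - running_cost S X)%E)// expect_payoff//.
  have := @supermartingale_bound R (const_strategy b) S S m k 0 1 0 1 mst
    hb hS hS m0 mm mp (lexx _) (lexx _).
  have [t ->] := expect_terminal_ex (const_strategy b) S k 0 1 mst.
  move=> H; apply: payoff_le_of; first by apply: expect_ge0 => X; exact: running_cost_ge0.
  (* An undecided game pays [mst <= 0], which is below every [m i]. *)
  apply: H => [i|i j j0]; first exact: le_trans mst0 (m0 i).
  exact: devm.
- have -> : exp_payoff_minus x 0 nst (const_strategy b) (const_strategy a) k = (n k)%:E.
    transitivity (expect (const_strategy b) (const_strategy a) k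
      (fun X => terminal x 0 nst X - running_cost (const_strategy b) X)%E); first by [].
    rewrite expect_payoff//.
    have := martingale_value nst hb ha hb n0x nm np en (esc k).
    have [t ->] := expect_terminal_ex (const_strategy b) (const_strategy a) k x 0 nst.
    have : (0 <= expect (const_strategy b) (const_strategy a) k
      (running_cost (const_strategy b)))%E.
      by apply: expect_ge0 => X; exact: running_cost_ge0.
    move: (expect _ _ k (running_cost _)) => [c| |]// _ [->].
    by apply: (congr1 EFin (_ : n k + c - c = _)); ring.
  rewrite (_ : exp_payoff_minus _ _ _ _ _ _ = expect S (const_strategy a) k
      (fun X => terminal x 0 nst X - running_cost S X)%E)// expect_payoff//.
  have := @supermartingale_bound R S (const_strategy a) S n k x 0 x 0 nst
    hS ha hS n0 nm np (lexx _) (lexx _).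
  have [t ->] := expect_terminal_ex S (const_strategy a) k x 0 nst.
  move=> H; apply: payoff_le_of; first by apply: expect_ge0 => X; exact: running_cost_ge0.
  apply: H => [i|i j j0]; first exact: le_trans nst0 (n0 i).
  exact: devn.
Qed.

End Equilibrium.

(** * Comparing payoffs of an equilibrium with those of deviations *)

Section NashToABMN.
Variable R : realType.
Implicit Types (Sm Sp Sc S : strategy R) (k i : int) (u : R) (X : nat -> int).
Implicit Types (a b m n f w : int -> R).
Local Notation mu := (@lebesgue_measure R).
Local Notation U := (`[0%R, 1%R]%classic : set R).

Definition agree S S' := forall i j, (0 < j)%N -> S i j = S' i j.

Definition payoff (vm vp vs : R) S X : \bar R :=
  (terminal vm vp vs X - running_cost S X)%E.

Lemma exp_payoff_plusE (vm vp vs : R) Sm Sp k :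
  exp_payoff_plus vm vp vs Sm Sp k = expect Sm Sp k (payoff vm vp vs Sp).
Proof. by []. Qed.

Lemma exp_payoff_minusE (vm vp vs : R) Sm Sp k :
  exp_payoff_minus vm vp vs Sm Sp k = expect Sm Sp k (payoff vm vp vs Sm).
Proof. by []. Qed.

Lemma expect_payoff_ext Sm Sp Sc Sm' Sp' Sc' k (vm vp vs : R) :
  agree Sm Sm' -> agree Sp Sp' -> agree Sc Sc' ->
  expect Sm Sp k (payoff vm vp vs Sc) = expect Sm' Sp' k (payoff vm vp vs Sc').
Proof.
move=> hm hp hc; apply: eq_integral => u _.
rewrite (gameplay_ext k u hm hp) /payoff; congr (_ - _)%E.
by apply: eq_eseriesr => t _; rewrite hc.
Qed.

(** After this replacement the tail of each strategy is the strategy itself. *)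
Lemma nash_const Sm Sp (x mst nst : R) : time_invariant Sm -> time_invariant Sp ->
  nash_equilibrium 0 1 x 0 mst nst Sm Sp ->
  nash_equilibrium 0 1 x 0 mst nst (const_strategy (Sm^~ 1%N)) (const_strategy (Sp^~ 1%N)).
Proof.
move=> tm tp [hm [hp hN]].
have am : agree Sm (const_strategy (Sm^~ 1%N)) by move=> i j j0; exact: tm.
have ap : agree Sp (const_strategy (Sp^~ 1%N)) by move=> i j j0; exact: tp.
split; first by move=> i j _; exact: hm.
split; first by move=> i j _; exact: hp.
move=> S hS k; have [h1 h2] := hN S hS k.
have refl S' : agree S' S' by [].
split.
- rewrite !exp_payoff_plusE -(expect_payoff_ext k 0 1 mst am (refl S) (refl S)).
  by rewrite -(expect_payoff_ext k 0 1 mst am ap ap).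
- rewrite !exp_payoff_minusE -(expect_payoff_ext k x 0 nst (refl S) ap (refl S)).
  by rewrite -(expect_payoff_ext k x 0 nst am ap am).
Qed.

(** With [w] the value of the continuation, this yields both the recursion for the equilibrium
    values and the payoff of a deviation in the first turn. *)
Lemma expect_payoff_step Sm Sp Sc Sm' Sp' Sc' w k (vm vp vs : R) :
  is_strategy Sm -> is_strategy Sp -> is_strategy Sc ->
  agree (tail_strategy Sm) Sm' -> agree (tail_strategy Sp) Sp' ->
  agree (tail_strategy Sc) Sc' ->
  (forall k, expect Sm' Sp' k (payoff vm vp vs Sc') = (w k)%:E) ->
  expect Sm Sp k (payoff vm vp vs Sc) =
  (share (Sm k 1%N) (Sp k 1%N) * w (k + 1) +
   (1 - share (Sm k 1%N) (Sp k 1%N)) * w (k - 1) - Sc k 1%N)%:E.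
Proof.
move=> hm hp hc am ap ac hw; rewrite -up_prob_share.
apply: (expect_payoff_first_step hm hp hc).
  by rewrite -(hw (k + 1)); exact: expect_payoff_ext.
by rewrite -(hw (k - 1)); exact: expect_payoff_ext.
Qed.

Lemma expect_payoff_le Sm Sp Sc k (vm vp vs hi : R) : is_strategy Sc ->
  vm <= hi -> vp <= hi -> vs <= hi -> (expect Sm Sp k (payoff vm vp vs Sc) <= hi%:E)%E.
Proof.
move=> hc h1 h2 h3; rewrite (expect_payoff Sm Sp k vm vp vs hc).
have c0 : (0 <= expect Sm Sp k (running_cost Sc))%E.
  by apply: expect_ge0 => X; exact: running_cost_ge0.
have : (expect Sm Sp k (terminal vm vp vs) <= hi%:E)%E.
  have e : expect Sm Sp k (terminal hi hi hi) = hi%:E.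
    rewrite -(expect_cst Sm Sp k hi); apply: eq_integral => u _.
    by rewrite /terminal; do 2 case: ifP => // _.
  by rewrite -e; exact: expect_terminal_le.
have [t ->] := expect_terminal_ex Sm Sp k vm vp vs => ht.
apply: payoff_le_of => //; apply: le_trans ht _; exact: leeDl.
Qed.

(** Staking nothing secures the least terminal value; as a deviation it bounds equilibrium values
    from below. *)
Lemma expect_payoff_zero_cost Sm Sp k (vm vp vs lo : R) :
  lo <= vm -> lo <= vp -> lo <= vs ->
  (lo%:E <= expect Sm Sp k (payoff vm vp vs (const_strategy (fun=> 0%R))))%E.
Proof.
move=> h1 h2 h3.
have h0 : is_strategy (const_strategy (fun=> 0 : R)) by move=> i j _; exact: lexx.
rewrite (expect_payoff Sm Sp k vm vp vs h0).
have -> : expect Sm Sp k (running_cost (const_strategy (fun=> 0 : R))) = 0%E.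
  transitivity (expect Sm Sp k (fun=> 0%:E)); last exact: expect_cst.
  by apply: eq_integral => u _; apply: eseries0.
rewrite sube0.
have e : expect Sm Sp k (terminal lo lo lo) = lo%:E.
  rewrite -(expect_cst Sm Sp k lo); apply: eq_integral => u _.
  by rewrite /terminal; do 2 case: ifP => // _.
by rewrite -e; exact: expect_terminal_le.
Qed.

Lemma expect_terminal_lin Sm Sp k (c d vm vp vs vm' vp' vs' : R) :
  (expect Sm Sp k (terminal (c * vm + d * vm') (c * vp + d * vp') (c * vs + d * vs')) =
   c%:E * expect Sm Sp k (terminal vm vp vs) +
   d%:E * expect Sm Sp k (terminal vm' vp' vs'))%E.
Proof.
have i1 := terminal_integrable Sm Sp k vm vp vs.
have i2 := terminal_integrable Sm Sp k vm' vp' vs'.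
rewrite /expect -integralZl// -integralZl// -integralD//; try exact: integrableZl.
apply: eq_integral => u _; rewrite !terminalE; apply: (congr1 EFin).
by rewrite /terminal_value; case: ifP => // _; case: ifP.
Qed.

Lemma expect_terminal_escapes Sm Sp k (vm vp vs vs' : R) : escapes_ae Sm Sp k ->
  expect Sm Sp k (terminal vm vp vs) = expect Sm Sp k (terminal vm vp vs').
Proof.
move=> hesc; apply: ae_eq_integral => //.
- by have /integrableP[] := terminal_integrable Sm Sp k vm vp vs.
- by have /integrableP[] := terminal_integrable Sm Sp k vm vp vs'.
apply: (@filterS _ _ (ae_filter_ringOfSetsType mu) _ _ _ hesc) => u hu Uu.
rewrite /terminal; case: ifPn => // /asboolP hm.
by case: (hu Uu) => // hp; rewrite asboolT.
Qed.

(** Here [h] is the probability of escaping to [+oo], and [1 - h] that of escaping to [-oo]. *)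
Lemma expect_terminal_hit Sm Sp k (vm vp vs : R) : escapes_ae Sm Sp k ->
  let h := fine (expect Sm Sp k (terminal 0 1 0)) in
  expect Sm Sp k (terminal vm vp vs) = (vm + (vp - vm) * h)%:E.
Proof.
move=> hesc h; rewrite (expect_terminal_escapes vm vp vs vm hesc).
have -> : terminal vm vp vm = terminal (vm * 1 + (vp - vm) * 0)
    (vm * 1 + (vp - vm) * 1) (vm * 1 + (vp - vm) * 0).
  by congr terminal; ring.
rewrite expect_terminal_lin.
have -> : expect Sm Sp k (terminal 1 1 1) = 1%:E.
  rewrite -(expect_cst Sm Sp k 1); apply: eq_integral => u _.
  by rewrite /terminal; do 2 case: ifP => // _.
rewrite /h; have [t ->] := expect_terminal_ex Sm Sp k 0 1 0.
by apply: (congr1 EFin (_ : vm * 1 + (vp - vm) * t = _)); rewrite mulr1.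
Qed.

Lemma expect_terminal_up Sm Sp k (vm vp vs : R) :
  (forall i j, (0 < j)%N -> up_prob Sm Sp i j = 1) ->
  expect Sm Sp k (terminal vm vp vs) = vp%:E.
Proof.
move=> hup.
have hgp u (n : nat) : u < 1 -> gp_state Sm Sp k u n = (k + n%:Z, 0, 1).
  move=> u1; elim: n => [|n ih]; first by rewrite addr0.
  rewrite gp_stateS ih/= hup// mul1r subr0 add0r u1; congr (_, _, _); lia.
have hX u : u < 1 -> terminal vm vp vs (gameplay Sm Sp k u) = vp%:E.
  move=> u1; have hp : escapes_plus R (gameplay Sm Sp k u).
    apply/escapes_plusP => B; exists `|B - k|%N => n hn.
    by rewrite /gameplay hgp//=; lia.
  have hm : ~ escapes_minus R (gameplay Sm Sp k u).
    by move=> /not_escapes_both; apply.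
  by rewrite /terminal asboolF// asboolT.
(* At [u = 1] the test [u < 1] fails and the walk steps down, so this null point is removed
   first. *)
rewrite -(expect_cst Sm Sp k vp) /expect.
rewrite -integral_itv_bndo_bndc; last first.
  apply: measurable_funS (_ : measurable_fun U _) => //.
    by apply: subset_itvl; rewrite bnd_simp.
  by have /integrableP[] := terminal_integrable Sm Sp k vm vp vs.
rewrite -[RHS]integral_itv_bndo_bndc; last exact: measurable_cst.
by apply: eq_integral => u; rewrite inE/= in_itv/= => /andP[_ u1]; exact: hX.
Qed.

Lemma expect_terminal_down Sm Sp k (vm vp vs : R) :
  (forall i j, (0 < j)%N -> up_prob Sm Sp i j = 0) ->
  expect Sm Sp k (terminal vm vp vs) = vm%:E.
Proof.
move=> hdn.
have hgp u (n : nat) : 0 <= u -> gp_state Sm Sp k u n = (k - n%:Z, 0, 1).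
  move=> u0; elim: n => [|n ih]; first by rewrite subr0.
  rewrite gp_stateS ih/= hdn// mul0r addr0 ltNge u0/=; congr (_, _, _); lia.
rewrite -(expect_cst Sm Sp k vm); apply: eq_integral => u.
rewrite inE/= in_itv/= => /andP[u0 _].
rewrite /terminal asboolT//; apply/escapes_minusP => B; exists `|B - k|%N => n hn.
by rewrite /gameplay hgp//=; lia.
Qed.

(** Positive stakes of total cost at most [e], which win every turn against an opponent staking
    nothing. *)
Definition vanishing_strategy (e : R) : strategy R := fun _ j => e / (2 ^ j)%:R.

Lemma vanishing_gt0 (e : R) i j : 0 < e -> 0 < vanishing_strategy e i j.
Proof. by move=> e0; rewrite divr_gt0// ltr0n expn_gt0. Qed.

Lemma vanishing_payoff (e v : R) Sm Sp k (vm vp vs : R) : 0 < e ->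
  expect Sm Sp k (terminal vm vp vs) = v%:E ->
  ((v - e)%:E <= expect Sm Sp k (payoff vm vp vs (vanishing_strategy e)))%E.
Proof.
move=> e0 hv.
have hs : is_strategy (vanishing_strategy e) by move=> i j _; rewrite ltW// vanishing_gt0.
rewrite (expect_payoff Sm Sp k vm vp vs hs) hv.
have : (expect Sm Sp k (running_cost (vanishing_strategy e)) <= e%:E)%E.
  rewrite -(expect_cst Sm Sp k e); apply: ge0_le_integral => //.
  - by move=> u _; exact: running_cost_ge0.
  - by apply: measurable_funTS; exact: measurable_running_cost.
  - move=> u _; rewrite /running_cost /vanishing_strategy.
    exact: (epsilon_trick0 xpredT (ltW e0)).
have : (0 <= expect Sm Sp k (running_cost (vanishing_strategy e)))%E.
  by apply: expect_ge0 => X; exact: running_cost_ge0.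
move: (expect Sm Sp k (running_cost _)) => [c| |]// _.
by rewrite lee_fin => ce; rewrite -EFinB lee_fin; lra.
Qed.

(* Both sides of the first equation are [w k] plus the expected total cost. *)
Lemma value_hit Sm Sp w k (c : int -> R) (lo hi vm vp vs lm lp : R) :
  is_strategy Sm -> is_strategy Sp -> (forall i, 0 < c i) ->
  expect Sm Sp k (payoff vm vp vs (const_strategy c)) = (w k)%:E ->
  (forall i, lo <= w i <= hi) -> lim_minfty w lm -> lim_pinfty w lp ->
  (forall i j, (0 < j)%N -> up_prob Sm Sp i j * w (i + 1) +
     (1 - up_prob Sm Sp i j) * w (i - 1) = w i + c i) ->
  let h := fine (expect Sm Sp k (terminal 0 1 0)) in
  vm + (vp - vm) * h = lm + (lp - lm) * h /\ w k <= lm + (lp - lm) * h.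
Proof.
move=> hm hp c0 hw wb wm wp hrec h.
have hc : is_strategy (const_strategy c) by move=> i j _; rewrite ltW// c0.
move: hw; rewrite (expect_payoff Sm Sp k vm vp vs hc).
have ec0 : (0 <= expect Sm Sp k (running_cost (const_strategy c)))%E.
  by apply: expect_ge0 => X; exact: running_cost_ge0.
have [t et] := expect_terminal_ex Sm Sp k vm vp vs.
rewrite et => /EFin_sub_eq ec.
(* A finite value entails a finite expected cost, and positive stakes then force escape. *)
have hesc : escapes_ae Sm Sp k.
  have cc i j : (0 < j)%N -> c i <= const_strategy c i j by [].
  by apply: (finite_cost_escapes hc c0 cc); rewrite ec ltry.
(* Subtracting [lo] gives the nonnegative function that [martingale_value] asks for. *)
have wK i : 0 <= w i - lo <= hi - lo by have := wb i; lra.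
have hrec' i j : (0 < j)%N -> up_prob Sm Sp i j * (w (i + 1) - lo) +
    (1 - up_prob Sm Sp i j) * (w (i - 1) - lo) = w i - lo + const_strategy c i j.
  move=> j0; transitivity (up_prob Sm Sp i j * w (i + 1) +
    (1 - up_prob Sm Sp i j) * w (i - 1) - lo); first by ring.
  by rewrite hrec// const_strategyE; ring.
have wm' : lim_minfty (fun i => w i - lo) (lm - lo) by apply: cvgB => //; exact: cvg_cst.
have wp' : lim_pinfty (fun i => w i - lo) (lp - lo) by apply: cvgB => //; exact: cvg_cst.
have := martingale_value 0 hm hp hc wK wm' wp' hrec' hesc.
rewrite expect_terminal_hit// ec -/h => -[e].
move: et; rewrite expect_terminal_hit// -/h => -[et].
move: ec0; rewrite ec lee_fin => ec0.
by split; lra.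
Qed.

Lemma fine_expect_hit_bound Sm Sp k :
  0 <= fine (expect Sm Sp k (terminal 0 1 0)) <= 1.
Proof. by apply: expect_terminal_bound; rewrite ?lexx ?ler01. Qed.

End NashToABMN.

(** * From a time-invariant equilibrium to a positive solution *)

Section EquilibriumMargin.
Variable R : realType.
Implicit Types (a b m n f : int -> R).

Definition one_shot f (c : R) : strategy R := fun i j => if j == 1%N then c else f i.

Lemma one_shot_is_strategy f (c : R) : (forall i, 0 <= f i) -> 0 <= c ->
  is_strategy (one_shot f c).
Proof. by move=> f0 c0 i j _; rewrite /one_shot; case: ifP. Qed.

Lemma one_shot_tail f (c : R) : agree (tail_strategy (one_shot f c)) (const_strategy f).
Proof. by move=> i [|j]. Qed.

Lemma const_tail f : agree (tail_strategy (const_strategy f)) (const_strategy f).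
Proof. by []. Qed.

(** Used to identify boundary limits: the fixed number [A] is dominated by a quantity tending to
    0. *)
Lemma cvg_bound_eq0 (u : nat -> R) (l A B : R) : u k @[k --> \oo] --> l ->
  (forall k, `|A| <= B * (l - u k)) -> A = 0.
Proof.
move=> ul h; apply/eqP; rewrite -normr_le0.
have hl : B * (l - u k) @[k --> \oo] --> B * (l - l).
  by apply: cvgM; [exact: cvg_cst|apply: cvgB => //; exact: cvg_cst].
rewrite -(mulr0 B) -(subrr l); apply: (cvgr_to_ge hl).
exact: nearW.
Qed.

Lemma nondecreasing_int_cvg f (lo hi : R) : (forall i, f i <= f (i + 1)) ->
  (forall i, lo <= f i <= hi) -> exists lm lp, lim_minfty f lm /\ lim_pinfty f lp.
Proof.
move=> nd fb.
have nd' := nondecreasing_int nd.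
exists (inf (range (fun k : nat => f (- k%:Z)))), (sup (range (fun k : nat => f k%:Z))).
split.
- apply: nonincreasing_cvgn.
    by move=> i j ij; apply: nd'; lia.
  by exists lo => _ [k _ <-]; have /andP[] := fb (- k%:Z).
- apply: nondecreasing_cvgn.
    by move=> i j ij; apply: nd'; lia.
  by exists hi => _ [k _ <-]; have /andP[] := fb k%:Z.
Qed.

(** The values are finite: each player can stake nothing, and no payoff exceeds the best terminal
    value. *)
Lemma nash_values a b (x mst nst : R) : 0 < x -> mst <= 0 -> nst <= 0 ->
  nash_equilibrium 0 1 x 0 mst nst (const_strategy b) (const_strategy a) ->
  exists m n, [/\ forall k, expect (const_strategy b) (const_strategy a) k
      (payoff 0 1 mst (const_strategy a)) = (m k)%:E,
    forall k, expect (const_strategy b) (const_strategy a) k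
      (payoff x 0 nst (const_strategy b)) = (n k)%:E,
    forall k, mst <= m k <= 1 & forall k, nst <= n k <= x].
Proof.
move=> x0 mst0 nst0 [hb [ha hN]].
have h0 : is_strategy (const_strategy (fun=> 0 : R)) by move=> i j _; exact: lexx.
pose Em k := expect (const_strategy b) (const_strategy a) k
      (payoff 0 1 mst (const_strategy a)).
pose En k := expect (const_strategy b) (const_strategy a) k
      (payoff x 0 nst (const_strategy b)).
have Em1 k : (mst%:E <= Em k)%E.
  have [h _] := hN _ h0 k; apply: le_trans h; apply: expect_payoff_zero_cost => //.
  exact: le_trans mst0 ler01.
have Em2 k : (Em k <= 1%:E)%E.
  by apply: expect_payoff_le => //; rewrite ?ler01// (le_trans mst0)// ler01.
have En1 k : (nst%:E <= En k)%E.
  have [_ h] := hN _ h0 k; apply: le_trans h; apply: expect_payoff_zero_cost => //.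
  exact: le_trans nst0 (ltW x0).
have En2 k : (En k <= x%:E)%E.
  by apply: expect_payoff_le => //; rewrite ?ltW// (le_lt_trans nst0).
have fm k : Em k = (fine (Em k))%:E.
  by move: (Em1 k) (Em2 k); case: (Em k).
have fn k : En k = (fine (En k))%:E.
  by move: (En1 k) (En2 k); case: (En k).
exists (fine \o Em), (fine \o En); split=> k /=; rewrite -?fm -?fn//.
  by rewrite -!lee_fin -fm Em1 Em2.
by rewrite -!lee_fin -fn En1 En2.
Qed.

Lemma nash_site a b m n (x mst nst : R) :
  nash_equilibrium 0 1 x 0 mst nst (const_strategy b) (const_strategy a) ->
  (forall k, expect (const_strategy b) (const_strategy a) k
      (payoff 0 1 mst (const_strategy a)) = (m k)%:E) ->
  (forall k, expect (const_strategy b) (const_strategy a) k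
      (payoff x 0 nst (const_strategy b)) = (n k)%:E) ->
  forall k,
  [/\ a k = 0, b k = 0, m (k + 1) <= m k <= m (k - 1) &
      n (k - 1) <= n k <= n (k + 1)] \/
  [/\ 0 < a k, 0 < b k,
      m (k + 1) - m k = 2 * a k + b k /\ m k - m (k - 1) = a k ^+ 2 / b k &
      n (k - 1) - n k = 2 * b k + a k /\ n k - n (k + 1) = b k ^+ 2 / a k].
Proof.
move=> [hb [ha hN]] hm hn k.
have a0 i : 0 <= a i by exact: (ha i 1%N isT).
have b0 i : 0 <= b i by exact: (hb i 1%N isT).
have em := expect_payoff_step k hb ha ha (@const_tail b) (@const_tail a) (@const_tail a) hm.
have en := expect_payoff_step k hb ha hb (@const_tail b) (@const_tail a) (@const_tail b) hn.
move: em en; rewrite hm hn => -[em] [en].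
apply: equilibrium_site => //.
- move=> c c0; have hS := one_shot_is_strategy a0 c0.
  have [h _] := hN _ hS k; move: h.
  rewrite !exp_payoff_plusE hm.
  rewrite (expect_payoff_step k hb hS hS (@const_tail b) (@one_shot_tail a c) (@one_shot_tail a c) hm).
  by rewrite lee_fin.
- move=> c c0; have hS := one_shot_is_strategy b0 c0.
  have [_ h] := hN _ hS k; move: h.
  rewrite !exp_payoff_minusE hn.
  rewrite (expect_payoff_step k hS ha hS (@one_shot_tail b c) (@const_tail a) (@one_shot_tail b c) hn).
  by rewrite lee_fin.
Qed.

(** Cheap winning deviations force [m 0 >= 1] and [n 0 >= x], so [x * m 0 + n 0 >= 2 * x]. But [x]
    times Maxine's terminal payoff plus Mina's never exceeds [x]. *)
Lemma nash_not_zero a b m n (x mst nst : R) : 0 < x -> mst <= 0 -> nst <= 0 ->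
  nash_equilibrium 0 1 x 0 mst nst (const_strategy b) (const_strategy a) ->
  (forall k, expect (const_strategy b) (const_strategy a) k
      (payoff 0 1 mst (const_strategy a)) = (m k)%:E) ->
  (forall k, expect (const_strategy b) (const_strategy a) k
      (payoff x 0 nst (const_strategy b)) = (n k)%:E) ->
  (forall k, a k = 0) -> (forall k, b k = 0) -> False.
Proof.
move=> x0 mst0 nst0 [hb [ha hN]] hm hn az bz.
have hs e : 0 < e -> is_strategy (@vanishing_strategy R e).
  by move=> e0 i j _; rewrite ltW// vanishing_gt0.
have m1 : 1 <= m 0.
  apply/ler_addgt0Pr => e e0; have [h _] := hN _ (hs e e0) 0.
  move: h; rewrite !exp_payoff_plusE hm => h.
  rewrite -lerBlDr -lee_fin.
  apply: le_trans h; apply: vanishing_payoff => //; apply: expect_terminal_up => i j j0.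
  rewrite up_prob_share const_strategyE bz share_pos add0r ?vanishing_gt0//.
  by rewrite divff// gt_eqF// vanishing_gt0.
have n1 : x <= n 0.
  apply/ler_addgt0Pr => e e0; have [_ h] := hN _ (hs e e0) 0.
  move: h; rewrite !exp_payoff_minusE hn => h.
  rewrite -lerBlDr -lee_fin.
  apply: le_trans h; apply: vanishing_payoff => //; apply: expect_terminal_down => i j j0.
  rewrite up_prob_share const_strategyE az share_pos addr0 ?vanishing_gt0//.
  by rewrite mul0r.
set Sm := const_strategy b in hm hn; set Sp := const_strategy a in hm hn.
have c0 S : is_strategy S -> (0 <= expect Sm Sp 0 (running_cost S))%E.
  by move=> hS; apply: expect_ge0 => X; exact: running_cost_ge0.
have sub_le (t w : R) (c : \bar R) : (0 <= c)%E -> (t%:E - c = w%:E)%E -> w <= t.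
  move=> hc /EFin_sub_eq ec; move: hc; rewrite ec lee_fin; lra.
have := hm 0; rewrite (expect_payoff Sm Sp 0 0 1 mst ha).
have [t et] := expect_terminal_ex Sm Sp 0 0 1 mst; rewrite et => /(sub_le _ _ _ (c0 _ ha)) mt.
have := hn 0; rewrite (expect_payoff Sm Sp 0 x 0 nst hb).
have [s es] := expect_terminal_ex Sm Sp 0 x 0 nst; rewrite es => /(sub_le _ _ _ (c0 _ hb)) ns.
(* The combined payoff is [x] on either escape and [x * mst + nst <= 0] otherwise. *)
have := expect_terminal_lin Sm Sp 0 x 1 0 1 mst x 0 nst.
rewrite et es => e.
have : (expect Sm Sp 0 (terminal (x * 0 + 1 * x) (x * 1 + 1 * 0) (x * mst + 1 * nst))
    <= expect Sm Sp 0 (terminal x x x))%E.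
  apply: expect_terminal_le; rewrite ?mulr0 ?mul1r ?add0r ?mulr1 ?addr0//.
  have : x * mst <= 0 by rewrite pmulr_rle0.
  lra.
rewrite e (_ : expect Sm Sp 0 (terminal x x x) = x%:E); last first.
  rewrite -(expect_cst Sm Sp 0 x); apply: eq_integral => u _.
  by rewrite /terminal; do 2 case: ifP => // _.
rewrite -!EFinM -EFinD lee_fin mul1r => h.
have : x * 1 <= x * t by rewrite ler_pM2l// (le_trans m1).
lra.
Qed.

Lemma nash_positive_margin Sm Sp (x mst nst : R) : 0 < x -> mst <= 0 -> nst <= 0 ->
  time_invariant Sm -> time_invariant Sp ->
  nash_equilibrium 0 1 x 0 mst nst Sm Sp -> positive_margins x.
Proof.
move=> x0 mst0 nst0 tm tp /(nash_const tm tp).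
set a := Sp^~ 1%N; set b := Sm^~ 1%N => hN.
have [m [n [hm hn mb nb]]] := nash_values x0 mst0 nst0 hN.
have site := nash_site hN hm hn.
(* A zero site [k] gives [m (k + 1) <= m k], whereas a positive site at either end of a step makes
   [m] strictly increase across it. Hence zeros spread in both directions. *)
have zero_next k : a k = 0 -> a (k + 1) = 0.
  move=> ak; case: (site k) => [[_ _ /andP[h _] _]|[]]; last by rewrite ak ltxx.
  case: (site (k + 1)) => [[]//|[a0 b0 [_ e] _]].
  have : 0 < a (k + 1) ^+ 2 / b (k + 1) by rewrite divr_gt0// exprn_gt0.
  by rewrite -e addrK; lra.
have zero_prev k : a k = 0 -> a (k - 1) = 0.
  move=> ak; case: (site k) => [[_ _ /andP[_ h] _]|[]]; last by rewrite ak ltxx.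
  case: (site (k - 1)) => [[]//|[a0 b0 [e _] _]].
  by move: e; rewrite subrK; lra.
have pos k : 0 < a k.
  case: (site k) => [[ak _ _ _]|[]//]; exfalso.
  have up d : a (k + d%:Z) = 0.
    elim: d => [|d ih]; first by rewrite addr0.
    by have -> : k + d.+1%:Z = k + d%:Z + 1 by [lia]; exact: zero_next.
  have dn d : a (k - d%:Z) = 0.
    elim: d => [|d ih]; first by rewrite subr0.
    by have -> : k - d.+1%:Z = k - d%:Z - 1 by [lia]; exact: zero_prev.
  have az i : a i = 0.
    have [h|h] := leP k i.
      by have -> : i = k + `|i - k|%N%:Z by [lia]; exact: up.
    by have -> : i = k - `|i - k|%N%:Z by [lia]; exact: dn.
  have bz i : b i = 0 by case: (site i) => [[]//|[]]; rewrite az ltxx.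
  exact: (nash_not_zero x0 mst0 nst0 hN hm hn az bz).
have gaps : site_gaps a b m n.
  move=> k; case: (site k) => [[ak]|[a0 b0 [e1 e2] [e3 e4]]]; last by split.
  by have := pos k; rewrite ak ltxx.
have bpos k : 0 < b k by have [[]] := gaps k.
have mnd i : m i <= m (i + 1) by rewrite ltW// (gaps_m_lt gaps).
have nnd i : - n i <= - n (i + 1) by rewrite lerN2 ltW// (gaps_n_lt gaps).
have [mm [mp [hmm hmp]]] := nondecreasing_int_cvg mnd mb.
have nb' i : - x <= - n i <= - nst by have := nb i; lra.
have [nm' [np' [hnm' hnp']]] := nondecreasing_int_cvg nnd nb'.
have nE : (fun i => - - n i) = n by apply/funext => i; rewrite opprK.
have := lim_minftyN hnm'; have := lim_pinftyN hnp'; rewrite nE.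
move: (- nm') (- np') => nm np hnp hnm {nm' np' hnm' hnp'}.
have [hb [ha _]] := hN.
have recm i j : (0 < j)%N -> up_prob (const_strategy b) (const_strategy a) i j * m (i + 1) +
     (1 - up_prob (const_strategy b) (const_strategy a) i j) * m (i - 1) = m i + a i.
  move=> _; have := expect_payoff_step i hb ha ha (@const_tail b) (@const_tail a) (@const_tail a) hm.
  by rewrite hm up_prob_share !const_strategyE => -[->]; rewrite subrK.
have recn i j : (0 < j)%N -> up_prob (const_strategy b) (const_strategy a) i j * n (i + 1) +
     (1 - up_prob (const_strategy b) (const_strategy a) i j) * n (i - 1) = n i + b i.
  move=> _; have := expect_payoff_step i hb ha hb (@const_tail b) (@const_tail a) (@const_tail b) hn.
  by rewrite hn up_prob_share !const_strategyE => -[->]; rewrite subrK.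
(* The probability of escaping to [+oo] from [k]. The prescribed end-values and the limits of [m]
   and [n] give the same affine combinations in [h k]; as [h k] tends to 1 on the right and to 0 on
   the left, they agree. *)
pose h k := fine (expect (const_strategy b) (const_strategy a) k (terminal 0 1 0)).
have hitm k := value_hit hb ha pos (hm k) mb hmm hmp recm.
have hitn k := value_hit hb ha bpos (hn k) nb hnm hnp recn.
have h01 k : 0 <= h k <= 1 by exact: fine_expect_hit_bound.
have mlt : mm < mp.
  apply: le_lt_trans (nondecreasing_int_ge_lim mnd hmm 0) _.
  exact: lt_le_trans (gaps_m_lt gaps 0) (nondecreasing_int_le_lim mnd hmp _).
have nlt : np < nm.
  rewrite -ltrN2.
  apply: le_lt_trans (nondecreasing_int_ge_lim nnd (lim_minftyN hnm) 0) _.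
  apply: lt_le_trans (nondecreasing_int_le_lim nnd (lim_pinftyN hnp) (0 + 1)).
  by rewrite ltrN2 (gaps_n_lt gaps).
have bound (A h' B d t : R) : 0 < d -> A = h' * B -> 0 <= h' -> d * h' <= t ->
    `|A| <= `|B| / d * t.
  move=> d0 -> h'0 ht; rewrite normrM (ger0_norm h'0) mulrC -mulrA ler_wpM2l//.
  by rewrite mulrC ler_pdivlMr// mulrC.
(* [1 - mp = (1 - h k) * (1 - (mp - mm))], and [(mp - mm) * (1 - h k) <= mp - m k] tends to 0. *)
have mp1 : 1 - mp = 0.
  apply: (cvg_bound_eq0 (B := `|1 - (mp - mm)| / (mp - mm)) hmp) => k.
  have [e1 e2] := hitm k%:Z; have := h01 k%:Z; rewrite -/(h _) in e1 e2 => hk.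
  apply: (bound _ (1 - h k%:Z)); rewrite ?subr_gt0//; nra.
have np0 : np = 0.
  apply: (cvg_bound_eq0 (B := `|x - (nm - np)| / (mp - mm)) hmp) => k.
  have [e1 e2] := hitm k%:Z; have [e3 _] := hitn k%:Z.
  have := h01 k%:Z; rewrite -/(h _) in e1 e2 e3 => hk.
  apply: (bound _ (1 - h k%:Z)); rewrite ?subr_gt0//; nra.
(* On the left, Mina's values control [h]: [(nm - np) * h (- k) <= nm - n (- k)]. *)
have mm0 : mm = 0.
  apply: (cvg_bound_eq0 (B := `|1 - (mp - mm)| / (nm - np)) hnm) => k.
  have [e1 _] := hitm (- k%:Z); have [e3 e4] := hitn (- k%:Z).
  have := h01 (- k%:Z); rewrite -/(h _) in e1 e3 e4 => hk.
  apply: (bound _ (h (- k%:Z))); rewrite ?subr_gt0//; nra.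
have nmx : x - nm = 0.
  apply: (cvg_bound_eq0 (B := `|x - (nm - np)| / (nm - np)) hnm) => k.
  have [e3 e4] := hitn (- k%:Z).
  have := h01 (- k%:Z); rewrite -/(h _) in e3 e4 => hk.
  apply: (bound _ (h (- k%:Z))); rewrite ?subr_gt0//; nra.
exists a, b, m, n; split; first exact/positive_ABMN_gaps.
exists mm, mp, nm, np; split=> //.
have -> : mp = 1 by lra.
have -> : nm = x by lra.
by rewrite mm0 np0 !subr0 divr1.
Qed.

End EquilibriumMargin.

(** * Series dominated by a geometric one *)

Section DominatedSeries.
Variable R : realType.
Implicit Types (f : nat -> R -> R) (K : R).

(** [S n] increases and [S n + 2 * K / 2 ^+ n] decreases, so the two sequences enclose the limit. *)
Lemma dominated_series (s : nat -> R) (K : R) :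
  (forall n, 0 <= s n <= K / 2 ^+ n) ->
  let S n := \sum_(j < n) s j in
  S n @[n --> \oo] --> limn S /\ forall n, S n <= limn S <= S n + 2 * K / 2 ^+ n.
Proof.
move=> hs S.
have p2 n : 0 < 2 ^+ n :> R by rewrite exprn_gt0.
have Snd : nondecreasing_seq S.
  apply/nondecreasing_seqP => n; rewrite /S big_ord_recr/= lerDl.
  by have /andP[] := hs n.
have Sni : nonincreasing_seq (fun n => S n + 2 * K / 2 ^+ n).
  apply/nonincreasing_seqP => n; rewrite /S big_ord_recr/= -addrA lerD2l.
  have /andP[_ h] := hs n; rewrite -lerBrDr; apply: le_trans h _.
  rewrite le_eqVlt; apply/orP; left; apply/eqP; rewrite exprS.
  by field; rewrite gt_eqF.
have K0 : 0 <= K by have := hs 0%N; rewrite expr0 divr1 => /andP[]; exact: le_trans.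
have e0 n : 0 <= 2 * K / 2 ^+ n by rewrite divr_ge0 ?mulr_ge0// ltW.
have Sub n m : S m <= S n + 2 * K / 2 ^+ n.
  have h1 : S m <= S (maxn n m) by apply: Snd; exact: leq_maxr.
  have h2 := Sni _ _ (leq_maxl n m).
  apply: le_trans h1 _; apply: le_trans h2; by rewrite lerDl.
have cS : cvgn S.
  apply: nondecreasing_is_cvgn => //; exists (S 0%N + 2 * K / 2 ^+ 0) => _ [m _ <-].
  exact: Sub.
split=> // n; apply/andP; split.
  exact: nondecreasing_cvgn_le.
by apply: limr_le => //; apply: nearW => m; exact: Sub.
Qed.

(** The Weierstrass test: tails are below [e / 3] uniformly on [D], and partial sums are
    continuous. *)
Lemma dominated_series_continuous f (K : R) (D : set R) (x : R) :
  (\forall y \near x, D y) ->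
  (forall n y, D y -> 0 <= f n y <= K / 2 ^+ n) ->
  (forall n, {for x, continuous (f n)}) ->
  {for x, continuous (fun y => limn (fun n => \sum_(j < n) f j y))}.
Proof.
move=> nD hf cf.
have Dx : D x by exact: nbhs_singleton nD.
have K0 : 0 <= K.
  by have := hf 0%N x Dx; rewrite expr0 divr1 => /andP[]; exact: le_trans.
apply/cvgrPdist_lt => e e0.
have [n hn] : exists n : nat, 2 * K / 2 ^+ n < e / 3.
  have h : 2 * K * (2^-1) ^+ n @[n --> \oo] --> 2 * K * 0.
    apply: cvgM; first exact: cvg_cst.
    by apply: cvg_expr; rewrite ger0_norm ?invr_ge0// invf_lt1// ltr1n.
  have /cvgrPdist_lt/(_ (e / 3)) := h.
  rewrite divr_gt0// => /(_ isT)[n _ /(_ n (leqnn n))].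
  rewrite mulr0 sub0r normrN exprVn => /ltr_normlW hn; by exists n.
have cS : {for x, continuous (fun y => \sum_(j < n) f j y)}.
  elim: n {hn} => [|n ih].
    have -> : (fun y => \sum_(j < 0) f j y) = cst 0 by apply/funext => y; rewrite big_ord0.
    exact: cvg_cst.
  have -> : (fun y => \sum_(j < n.+1) f j y) = (fun y => \sum_(j < n) f j y + f n y).
    by apply/funext => y; rewrite big_ord_recr.
  by apply: cvgD; [exact: ih|exact: cf].
have /cvgrPdist_lt/(_ (e / 3)) := cS; rewrite divr_gt0// => /(_ isT) nS.
near=> y.
have Dy : D y by near: y.
have := (dominated_series (fun n => hf n x Dx)).2 n.
have := (dominated_series (fun n => hf n y Dy)).2 n.
have : `|\sum_(j < n) f j x - \sum_(j < n) f j y| < e / 3 by near: y.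
rewrite !ltr_norml => h1 h2 h3; apply/andP; split; lra.
Unshelve. all: by end_near. Qed.

End DominatedSeries.

(** * The ratio recursion and the margin function *)

Section RatioOrbit.
Variable R : realType.
Implicit Types (t r s : R).

(* If [rho i = b i / a i] then [rho (i + 1) = next_ratio (rho i)]: the positive
   root [s] of [s * (1 + 2 * s) * (2 + rho i) = rho i ^+ 2]. *)
Definition next_ratio t : R := (Num.sqrt (1 + 8 * (t ^+ 2 / (2 + t))) - 1) / 4.

Lemma next_ratioE t : 0 < t ->
  next_ratio t * (1 + 2 * next_ratio t) * (2 + t) = t ^+ 2.
Proof.
move=> t0; rewrite /next_ratio; set w := t ^+ 2 / (2 + t).
have d0 : 0 < 2 + t by lra.
have w0 : 0 <= w by rewrite divr_ge0 ?sqr_ge0// ltW.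
have hs : Num.sqrt (1 + 8 * w) ^+ 2 = 1 + 8 * w by rewrite sqr_sqrtr//; lra.
move: hs; set q := Num.sqrt _ => hs.
have -> : (q - 1) / 4 * (1 + 2 * ((q - 1) / 4)) = (q ^+ 2 - 1) / 8 by field.
by rewrite hs /w; field; rewrite gt_eqF.
Qed.

Lemma next_ratio_gt0 t : 0 < t -> 0 < next_ratio t.
Proof.
move=> t0; rewrite /next_ratio divr_gt0// subr_gt0.
have w0 : 0 < t ^+ 2 / (2 + t) by rewrite divr_gt0 ?exprn_gt0//; lra.
rewrite -[ltLHS]sqrtr1 ltr_sqrt; lra.
Qed.

Lemma next_ratio_unique t s : 0 < t -> 0 < s ->
  s * (1 + 2 * s) * (2 + t) = t ^+ 2 -> s = next_ratio t.
Proof.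
move=> t0 s0 e; have r0 := next_ratio_gt0 t0; have er := next_ratioE t0.
move: (next_ratio t) r0 er => r r0 er.
have : (s - r) * ((1 + 2 * (s + r)) * (2 + t)) = 0.
  transitivity (s * (1 + 2 * s) * (2 + t) - r * (1 + 2 * r) * (2 + t)); first by ring.
  by rewrite e er subrr.
move/eqP; rewrite mulf_eq0 subr_eq0 => /orP[/eqP//|].
by rewrite gt_eqF// mulr_gt0//; lra.
Qed.

Lemma next_ratio_le t : 0 < t -> next_ratio t <= t / 4.
Proof.
move=> t0; have r0 := next_ratio_gt0 t0; have er := next_ratioE t0.
move: (next_ratio t) r0 er => r r0 er; rewrite leNgt; apply/negP => h.
(* [s * (1 + 2 * s)] increases in [s], so it suffices to test [s = t / 4]; there the defect is
   [t / 8 * (t - 2)^2], with equality at [t = 2]. *)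
have h1 : (t / 4) * (1 + 2 * (t / 4)) < r * (1 + 2 * r).
  by apply: ltr_pM => //; rewrite ?divr_ge0 ?ltW//; lra.
have h2 : (t / 4) * (1 + 2 * (t / 4)) * (2 + t) < t ^+ 2.
  by rewrite -er ltr_pM2r//; lra.
suff : t ^+ 2 <= (t / 4) * (1 + 2 * (t / 4)) * (2 + t) by rewrite leNgt h2.
rewrite -subr_ge0 (_ : _ - _ = t / 8 * (t - 2) ^+ 2); last by field.
by rewrite mulr_ge0 ?sqr_ge0// divr_ge0// ltW.
Qed.

(** [1 / 5] is a convenient rational below [next_ratio 1]: there [s * (1 + 2 * s) = 7 / 25], and
    [7 / 25 * (2 + t) < t^2] for [t >= 1]. *)
Lemma next_ratio_ge t : 1 <= t -> 1 / 5 <= next_ratio t.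
Proof.
move=> t1; have t0 : 0 < t by lra.
have r0 := next_ratio_gt0 t0; have er := next_ratioE t0.
move: (next_ratio t) r0 er => r r0 er; rewrite leNgt; apply/negP => h.
have h1 : r * (1 + 2 * r) < 7 / 25.
  rewrite (_ : 7 / 25 = 1 / 5 * (7 / 5)); last by field.
  by apply: ltr_pM => //; rewrite ?ltW//; lra.
have h2 : t ^+ 2 < 7 / 25 * (2 + t) by rewrite -er ltr_pM2r//; lra.
by have : t * 1 <= t * t by [rewrite ler_pM2l]; rewrite -expr2; lra.
Qed.

Lemma next_ratio_continuous t : 0 < t -> {for t, continuous next_ratio}.
Proof.
move=> t0.
have ci : {for t, continuous (fun y : R => 1 + 8 * (y ^+ 2 / (2 + y)))}.
  apply: cvgD; first exact: cvg_cst.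
  apply: cvgM; first exact: cvg_cst.
  apply: cvgM; first by apply: (@exprn_continuous R 2).
  apply: cvgV; first by rewrite gt_eqF//; lra.
  by apply: cvgD => //; exact: cvg_cst.
have cs := continuous_comp ci (@sqrt_continuous R _).
apply: cvgM; last exact: cvg_cst.
by apply: cvgB; [exact: cs|exact: cvg_cst].
Qed.

Definition ratio n t := iter n next_ratio t.

(** Maxine's stakes at the sites [n >= 0] of the solution with [a 0 = 1] and [rho 0 = t];
    [gaps_step] justifies the recursion. *)
Fixpoint stake n t : R :=
  if n is n'.+1 then stake n' t * (ratio n t * (2 + ratio n' t)) else 1.

(** This is [2 * a + b] at site [n], and [n_gap] is [b^2 / a], both written with [b = rho * a]. *)
Definition m_gap n t := stake n t * (2 + ratio n t).
Definition n_gap n t := stake n t * ratio n t ^+ 2.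

Lemma stakeS n t : stake n.+1 t = stake n t * (ratio n.+1 t * (2 + ratio n t)).
Proof. by []. Qed.

Lemma ratio_gt0 n t : 0 < t -> 0 < ratio n t.
Proof. by move=> t0; elim: n => //= n ih; exact: next_ratio_gt0. Qed.

Lemma stake_gt0 n t : 0 < t -> 0 < stake n t.
Proof.
move=> t0; elim: n => [|n ih]; first exact: ltr01.
rewrite stakeS mulr_gt0// mulr_gt0 ?ratio_gt0//.
by have := ratio_gt0 n t0; lra.
Qed.

Lemma ratio_step n t : 0 < t ->
  ratio n.+1 t * (1 + 2 * ratio n.+1 t) * (2 + ratio n t) = ratio n t ^+ 2.
Proof. by move=> t0; exact: next_ratioE (ratio_gt0 n t0). Qed.

(** The gap of [m] between [n] and [n.+1] seen from its right end, where it is [a^2 / b]; [stakeS_n]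
    does the same for the other gap, and there the ratio recursion enters. *)
Lemma stakeS_m n t : 0 < t -> stake n.+1 t / ratio n.+1 t = m_gap n t.
Proof.
move=> t0; rewrite stakeS /m_gap; field.
by rewrite gt_eqF// ratio_gt0.
Qed.

Lemma stakeS_n n t : 0 < t -> stake n.+1 t * (1 + 2 * ratio n.+1 t) = n_gap n t.
Proof. by move=> t0; rewrite stakeS /n_gap -ratio_step//; ring. Qed.

Lemma ratio_le n t : 0 < t -> ratio n t <= t / 4 ^+ n.
Proof.
move=> t0; elim: n => [|n ih]; first by rewrite expr0 divr1.
apply: le_trans (next_ratio_le (ratio_gt0 n t0)) _.
rewrite exprSr invfM mulrA ler_pM2r// invr_gt0//.
Qed.

Lemma ratio_noninc n t : 0 < t -> ratio n t <= t.
Proof.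
move=> t0; elim: n => [//|n ih]; apply: le_trans ih.
apply: le_trans (next_ratio_le (ratio_gt0 n t0)) _.
by have := ratio_gt0 n t0; rewrite -/(ratio n t); lra.
Qed.

Lemma stakeS_le n t : 0 < t -> stake n.+1 t <= stake n t * ratio n t ^+ 2.
Proof.
move=> t0; rewrite -/(n_gap n t) -stakeS_n// ler_peMr ?ltW ?stake_gt0//.
by have := ratio_gt0 n.+1 t0; lra.
Qed.

(* An orbit enters [[1/5, 1]] right after leaving []1, +oo[], and the two halves of
   a solution are parametrised by [t] and [t^-1]: bounds on []0, 6[], an open
   neighbourhood of [[1/5, 5]], are enough. *)
Lemma stake_le n t : 0 < t < 6 -> stake n t <= 400 / 2 ^+ n.
Proof.
move=> /andP[t0 t6].
have sq s B : 0 < s -> s <= B -> s ^+ 2 <= B ^+ 2.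
  by move=> s0 sB; rewrite ler_sqr// nnegrE ltW// (lt_le_trans s0).
have r1 : ratio 1 t <= 3 / 2 by have := ratio_le 1 t0; rewrite expr1; lra.
have rn j : ratio j.+2 t <= 3 / 8.
  elim: j => [|j ih]; first by have := ratio_le 2 t0; rewrite expr2; lra.
  apply: le_trans (next_ratio_le (ratio_gt0 j.+2 t0)) _; rewrite -/(ratio j.+2 t).
  by have := ratio_gt0 j.+2 t0; lra.
have s0 : stake 0 t = 1 by [].
have s1 : stake 1 t <= 36.
  apply: le_trans (stakeS_le 0 t0) _; rewrite s0 mul1r.
  by have := sq t 6 t0 (ltW t6); rewrite /ratio/=; lra.
have s2 : stake 2 t <= 100.
  apply: le_trans (stakeS_le 1 t0) _.
  have h := sq _ _ (ratio_gt0 1 t0) r1.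
  have : stake 1 t * ratio 1 t ^+ 2 <= 36 * (3 / 2) ^+ 2.
    by apply: ler_pM => //; rewrite ?sqr_ge0// ltW// stake_gt0.
  lra.
(* The values at 0, 1, 2 are at most 1, 36 and [100 = 400 / 2^2]; afterwards each factor is at most
   [(3 / 8)^2 < 1 / 2]. *)
case: n => [|[|n]]; rewrite ?expr0 ?expr1; try lra.
elim: n => [|n ih]; first by apply: le_trans s2 _; rewrite expr2; lra.
apply: le_trans (stakeS_le n.+2 t0) _.
have h := sq _ _ (ratio_gt0 n.+2 t0) (rn n).
have -> : 400 / 2 ^+ n.+3 = 400 / 2 ^+ n.+2 * (1 / 2) :> R.
  by rewrite [2 ^+ n.+3]exprS; field; rewrite expf_neq0// pnatr_eq0.
apply: (ler_pM (ltW (stake_gt0 _ t0)) (sqr_ge0 _) ih).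
by apply: le_trans h _; lra.
Qed.

Lemma m_gap_bound n t : 0 < t < 6 -> 0 <= m_gap n t <= 14400 / 2 ^+ n.
Proof.
move=> ht; have t0 : 0 < t by case/andP: ht.
have s := stake_le n ht; have s0 := stake_gt0 n t0.
have r := ratio_noninc n t0; have r0 := ratio_gt0 n t0.
have p2 : 0 < 2 ^+ n :> R by rewrite exprn_gt0.
apply/andP; split; first by rewrite mulr_ge0// ?ltW//; lra.
(* [2 + ratio n t < 8] would allow less; 36 is the bound for [ratio n t ^+ 2], so both gaps share
   one constant. *)
have -> : 14400 / 2 ^+ n = 400 / 2 ^+ n * 36 :> R by field; rewrite gt_eqF.
by apply: ler_pM => //; rewrite ?ltW//; case/andP: ht => *; lra.
Qed.

Lemma n_gap_bound n t : 0 < t < 6 -> 0 <= n_gap n t <= 14400 / 2 ^+ n.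
Proof.
move=> ht; have t0 : 0 < t by case/andP: ht.
have s := stake_le n ht; have s0 := stake_gt0 n t0.
have r := ratio_noninc n t0; have r0 := ratio_gt0 n t0.
have p2 : 0 < 2 ^+ n :> R by rewrite exprn_gt0.
apply/andP; split; first by rewrite mulr_ge0// ?sqr_ge0// ltW.
have -> : 14400 / 2 ^+ n = 400 / 2 ^+ n * 6 ^+ 2 :> R by field; rewrite gt_eqF.
apply: (ler_pM (ltW s0) (sqr_ge0 _) s).
by rewrite ler_sqr ?nnegrE ?ltW//; case/andP: ht => *; lra.
Qed.

Lemma ratio_continuous n t : 0 < t -> {for t, continuous (ratio n)}.
Proof.
move=> t0; elim: n => [|n ih]; first exact: cvg_id.
exact: (continuous_comp ih (next_ratio_continuous (ratio_gt0 n t0))).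
Qed.

Lemma stake_continuous n t : 0 < t -> {for t, continuous (stake n)}.
Proof.
move=> t0; elim: n => [|n ih]; first exact: cvg_cst.
apply: cvgM => //; apply: cvgM; first exact: ratio_continuous.
by apply: cvgD; [exact: cvg_cst|exact: ratio_continuous].
Qed.

Lemma m_gap_continuous n t : 0 < t -> {for t, continuous (m_gap n)}.
Proof.
move=> t0; apply: cvgM; first exact: stake_continuous.
by apply: cvgD; [exact: cvg_cst|exact: ratio_continuous].
Qed.

Lemma n_gap_continuous n t : 0 < t -> {for t, continuous (n_gap n)}.
Proof.
move=> t0; apply: cvgM; first exact: stake_continuous.
by rewrite expr2; under eq_fun do rewrite expr2; apply: cvgM; exact: ratio_continuous.
Qed.

(** The total variation of [m] to the right of site 0 in the solution normalised by [a 0 = 1];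
    [n_tail] is that of [n]. *)
Definition m_tail t : R := limn (fun n => \sum_(j < n) m_gap j t).
Definition n_tail t : R := limn (fun n => \sum_(j < n) n_gap j t).

Lemma m_tail_cvg t : 0 < t < 6 -> \sum_(j < n) m_gap j t @[n --> \oo] --> m_tail t.
Proof. by move=> ht; have [] := dominated_series (fun n => m_gap_bound n ht). Qed.

Lemma n_tail_cvg t : 0 < t < 6 -> \sum_(j < n) n_gap j t @[n --> \oo] --> n_tail t.
Proof. by move=> ht; have [] := dominated_series (fun n => n_gap_bound n ht). Qed.

Lemma m_tail_gt0 t : 0 < t < 6 -> 0 < m_tail t.
Proof.
move=> ht; have [_ /(_ 1%N)/andP[h _]] := dominated_series (fun n => m_gap_bound n ht).
apply: lt_le_trans h; rewrite big_ord1 /m_gap mul1r /ratio/=.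
by case/andP: ht => *; lra.
Qed.

Lemma n_tail_ge0 t : 0 < t < 6 -> 0 <= n_tail t.
Proof.
move=> ht; have [_ /(_ 0%N)/andP[h _]] := dominated_series (fun n => n_gap_bound n ht).
by apply: le_trans h; rewrite big_ord0.
Qed.

Lemma near_itv06 t : 0 < t < 6 -> \forall y \near t, 0 < y < 6.
Proof.
move=> /andP[t0 t6]; near=> y; apply/andP; split; near: y.
  exact: lt_nbhsr.
exact: lt_nbhsl.
Unshelve. all: by end_near. Qed.

Lemma m_tail_continuous t : 0 < t < 6 -> {for t, continuous m_tail}.
Proof.
move=> ht; apply: (@dominated_series_continuous _ m_gap 14400 [set y | 0 < y < 6]).
- exact: near_itv06.
- by move=> n y; exact: m_gap_bound.
- by move=> n; apply: m_gap_continuous; case/andP: ht.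
Qed.

Lemma n_tail_continuous t : 0 < t < 6 -> {for t, continuous n_tail}.
Proof.
move=> ht; apply: (@dominated_series_continuous _ n_gap 14400 [set y | 0 < y < 6]).
- exact: near_itv06.
- by move=> n y; exact: n_gap_bound.
- by move=> n; apply: n_gap_continuous; case/andP: ht.
Qed.

(** To the left of site 0 the solution is a reflected one: players exchanged, parameter [t^-1],
    scale [b 0 = t]. The numerator is thus the total drop of [n] and the denominator the total rise
    of [m]. *)
Definition margin t : R :=
  (n_tail t + t * m_tail t^-1) / (m_tail t + t * n_tail t^-1).

Lemma inv_fifth_five t : 1 / 5 <= t <= 5 ->
  [/\ 0 < t, 0 < t < 6, 0 < t^-1 < 6 & 1 / 5 <= t^-1 <= 5].
Proof.
move=> /andP[h1 h2]; have t0 : 0 < t by lra.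
have tv0 : 0 < t^-1 by rewrite invr_gt0.
have h3 : t^-1 <= 5 by rewrite invf_ple ?posrE//; lra.
have h4 : 1 / 5 <= t^-1 by rewrite div1r lef_pV2 ?posrE.
by split=> //; lra.
Qed.

Lemma margin_num_gt0 t : 1 / 5 <= t <= 5 -> 0 < n_tail t + t * m_tail t^-1.
Proof.
move=> /inv_fifth_five[t0 ht htv _]; apply: ltr_wpDl; first exact: n_tail_ge0.
by rewrite mulr_gt0// m_tail_gt0.
Qed.

Lemma margin_den_gt0 t : 1 / 5 <= t <= 5 -> 0 < m_tail t + t * n_tail t^-1.
Proof.
move=> /inv_fifth_five[t0 ht htv _]; apply: ltr_pwDl; first exact: m_tail_gt0.
by apply: mulr_ge0; [exact: ltW|exact: n_tail_ge0].
Qed.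

Lemma margin_gt0 t : 1 / 5 <= t <= 5 -> 0 < margin t.
Proof. by move=> ht; rewrite divr_gt0 ?margin_num_gt0 ?margin_den_gt0. Qed.

(** Inverting [t] exchanges numerator and denominator up to the common factor [t^-1]. *)
Lemma marginV t : 1 / 5 <= t <= 5 -> margin t^-1 = (margin t)^-1.
Proof.
move=> ht; have [t0 _ _ htv] := inv_fifth_five ht.
have := margin_num_gt0 ht; have := margin_den_gt0 ht.
have := margin_num_gt0 htv; have := margin_den_gt0 htv.
rewrite /margin invrK => h1 h2 h3 h4.
by field; rewrite !gt_eqF// 1?addrC//.
Qed.

Lemma margin_continuous t : 1 / 5 <= t <= 5 -> {for t, continuous margin}.
Proof.
move=> ht; have [t0 h6 h6v _] := inv_fifth_five ht.
have cv : {for t, continuous (fun y : R => y^-1)}.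
  by apply: cvgV => //; rewrite gt_eqF.
have cmv : {for t, continuous (fun y : R => m_tail y^-1)}.
  exact: (continuous_comp cv (m_tail_continuous h6v)).
have cnv : {for t, continuous (fun y : R => n_tail y^-1)}.
  exact: (continuous_comp cv (n_tail_continuous h6v)).
apply: cvgM.
  apply: cvgD; first exact: n_tail_continuous.
  by apply: cvgM.
apply: cvgV; first by rewrite gt_eqF// margin_den_gt0.
apply: cvgD; first exact: m_tail_continuous.
by apply: cvgM.
Qed.

End RatioOrbit.

(** * Classification of positive solutions and the set of margins *)

Section Margins.
Variable R : realType.
Implicit Types (a b m n f : int -> R) (t : R).

Lemma site_gaps_normalize a b m n (c c' d : R) : 0 < d -> site_gaps a b m n ->
  site_gaps (fun i => a i / d) (fun i => b i / d)
    (fun i => (m i - c) / d) (fun i => (n i - c') / d).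
Proof.
move=> d0 h i; have [[a0 b0] e1 e2 e3 e4] := h i.
have sub (x y z : R) : (x - z) / d - (y - z) / d = (x - y) / d by ring.
rewrite !sub e1 e2 e3 e4; split; first by split; rewrite divr_gt0.
all: by field; rewrite !gt_eqF.
Qed.

Lemma site_gaps_reflect a b m n : site_gaps a b m n ->
  site_gaps (fun i => b (- i)) (fun i => a (- i)) (fun i => n (- i)) (fun i => m (- i)).
Proof.
move=> h i; have [[a0 b0] e1 e2 e3 e4] := h (- i).
rewrite (_ : - (i + 1) = - i - 1); last by lia.
by rewrite (_ : - (i - 1) = - i + 1); last by lia.
Qed.

Lemma site_gaps_shift a b m n k : site_gaps a b m n ->
  site_gaps (fun i => a (i + k)) (fun i => b (i + k)) (fun i => m (i + k)) (fun i => n (i + k)).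
Proof.
move=> h i; have := h (i + k).
rewrite (_ : i + k + 1 = i + 1 + k); last by lia.
by rewrite (_ : i + k - 1 = i - 1 + k); last by lia.
Qed.

Lemma lim_pinfty_shift f k (l : R) : lim_pinfty f l -> lim_pinfty (fun i => f (i + k)) l.
Proof.
(* The shifted index is viewed as an escaping path. *)
move=> h; apply: (cvg_escapes_plus h (X := fun j => j%:Z + k)).
by apply/escapes_plusP => B; exists `|B - k|%N => j; lia.
Qed.

Lemma lim_minfty_shift f k (l : R) : lim_minfty f l -> lim_minfty (fun i => f (i + k)) l.
Proof.
move=> h; apply: (cvg_escapes_minus h (X := fun j => - j%:Z + k)).
by apply/escapes_minusP => B; exists `|B - k|%N => j; lia.
Qed.

Lemma lim_pinfty_reflect f (l : R) : lim_minfty f l -> lim_pinfty (fun i => f (- i)) l.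
Proof. by []. Qed.

(** On the left half the reflected solution of parameter [t^-1] is used, so stakes [a] and [b] trade
    places, and the factor [t] matches [b 0]. [Negz k] stands for the site [-(k + 1)]. *)
Definition sol_a t (i : int) : R := match i with
  | Posz k => stake k t | Negz k => t * (stake k.+1 t^-1 * ratio k.+1 t^-1) end.
Definition sol_b t (i : int) : R := match i with
  | Posz k => stake k t * ratio k t | Negz k => t * stake k.+1 t^-1 end.
Definition sol_m t (i : int) : R := match i with
  | Posz k => \sum_(j < k) m_gap j t | Negz k => - (t * \sum_(j < k.+1) n_gap j t^-1) end.
Definition sol_n t (i : int) : R := match i with
  | Posz k => - \sum_(j < k) n_gap j t | Negz k => t * \sum_(j < k.+1) m_gap j t^-1 end.

Lemma sol_mN t k : sol_m t (- k%:Z) = - (t * \sum_(j < k) n_gap j t^-1).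
Proof.
case: k => [|k]; first by rewrite oppr0 /= !big_ord0 mulr0 oppr0.
by have -> : - k.+1%:Z = Negz k by [].
Qed.

Lemma sol_nN t k : sol_n t (- k%:Z) = t * \sum_(j < k) m_gap j t^-1.
Proof.
case: k => [|k]; first by rewrite oppr0 /= !big_ord0 mulr0 oppr0.
by have -> : - k.+1%:Z = Negz k by [].
Qed.

Lemma solution_gaps t : 0 < t -> site_gaps (sol_a t) (sol_b t) (sol_m t) (sol_n t).
Proof.
move=> t0; have s0 : 0 < t^-1 by rewrite invr_gt0.
have Sm j s : \sum_(i < j.+1) m_gap i s = \sum_(i < j) m_gap i s + m_gap j s :> R.
  by rewrite big_ord_recr.
have Sn j s : \sum_(i < j.+1) n_gap i s = \sum_(i < j) n_gap i s + n_gap j s :> R.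
  by rewrite big_ord_recr.
case=> [[|k]|k].
(* Site 0, where the two halves are glued. *)
- have -> : 0%:Z - 1 = Negz 0 by [].
  have -> : 0%:Z + 1 = Posz 1 by [].
  rewrite /sol_a /sol_b /sol_m /sol_n !big_ord1 !big_ord0 /m_gap /n_gap /= /ratio /=.
  have nz : t != 0 by rewrite gt_eqF.
  split; [by rewrite ltr01 mul1r|by field|by field|by field|by field].
(* Positive sites: right gaps hold by definition, left gaps by [stakeS_m] and [stakeS_n]. *)
- have -> : k.+1%:Z - 1 = k%:Z by lia.
  have -> : k.+1%:Z + 1 = k.+2%:Z by lia.
  rewrite /sol_a /sol_b /sol_m /sol_n.
  have g0 := stake_gt0 k.+1 t0; have r0 := ratio_gt0 k.+1 t0.
  split; first by split=> //; rewrite mulr_gt0.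
  + by rewrite [X in X - _]Sm /m_gap addrAC subrr add0r; ring.
  + rewrite [X in X - _]Sm addrAC subrr add0r -stakeS_m//.
    by field; rewrite !gt_eqF.
  + rewrite [X in _ - - X]Sn -stakeS_n//; ring.
  + rewrite [X in _ - - X]Sn /n_gap.
    by field; rewrite !gt_eqF.
(* Negative sites: the same computation at [t^-1] with the players exchanged. *)
- have em : sol_m t (Negz k) = - (t * \sum_(j < k.+1) n_gap j t^-1) by [].
  have en : sol_n t (Negz k) = t * \sum_(j < k.+1) m_gap j t^-1 by [].
  have e1 : Negz k + 1 = - k%:Z by lia.
  have e2 : Negz k - 1 = - k.+2%:Z by lia.
  rewrite e1 e2 em en !sol_mN !sol_nN /sol_a /sol_b.
  have g0 := stake_gt0 k.+1 s0; have r0 := ratio_gt0 k.+1 s0.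
  split; first exact: (conj (mulr_gt0 t0 (mulr_gt0 g0 r0)) (mulr_gt0 t0 g0)).
  + rewrite [X in _ - - (_ * X)]Sn -stakeS_n//; ring.
  + rewrite [X in _ - - (_ * X)]Sn /n_gap.
    by field; rewrite !gt_eqF.
  + rewrite [X in _ * X - _]Sm /m_gap; ring.
  + rewrite [X in _ * X - _]Sm -stakeS_m//.
    by field; rewrite !gt_eqF.
Qed.

Lemma solution_limits t : 1 / 5 <= t <= 5 ->
  [/\ lim_minfty (sol_m t) (- (t * n_tail t^-1)), lim_pinfty (sol_m t) (m_tail t),
      lim_minfty (sol_n t) (t * m_tail t^-1) & lim_pinfty (sol_n t) (- n_tail t)].
Proof.
move=> /inv_fifth_five[t0 h6 h6v _]; split.
- rewrite /lim_minfty; under eq_fun do rewrite sol_mN.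
  by apply: cvgN; apply: cvgM; [exact: cvg_cst|exact: n_tail_cvg].
- exact: m_tail_cvg.
- rewrite /lim_minfty; under eq_fun do rewrite sol_nN.
  by apply: cvgM; [exact: cvg_cst|exact: m_tail_cvg].
- by apply: cvgN; exact: n_tail_cvg.
Qed.

Lemma margin_normalized t : 1 / 5 <= t <= 5 -> exists a b m n,
  [/\ site_gaps a b m n, lim_minfty m 0, lim_pinfty m 1,
      lim_minfty n (margin t) & lim_pinfty n 0].
Proof.
move=> ht; have [t0 _ _ _] := inv_fifth_five ht.
have [l1 l2 l3 l4] := solution_limits ht; have d0 := margin_den_gt0 ht.
set d := m_tail t + t * n_tail t^-1 in d0.
exists (fun i => sol_a t i / d), (fun i => sol_b t i / d),
  (fun i => (sol_m t i - - (t * n_tail t^-1)) / d),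
  (fun i => (sol_n t i - - n_tail t) / d).
have lm f (g : nat -> int) (l c : R) : f (g k) @[k --> \oo] --> l ->
    (f (g k) - c) / d @[k --> \oo] --> (l - c) / d.
  by move=> h; apply: cvgM; [apply: cvgB => //; exact: cvg_cst|exact: cvg_cst].
split.
- exact: site_gaps_normalize (solution_gaps t0).
- have := lm _ _ _ (- (t * n_tail t^-1)) l1; rewrite subrr mul0r; exact.
- have := lm _ _ _ (- (t * n_tail t^-1)) l2; rewrite opprK divff ?gt_eqF//; exact.
- have := lm _ _ _ (- n_tail t) l3; rewrite opprK [_ + n_tail t]addrC; exact.
- have := lm _ _ _ (- n_tail t) l4; rewrite subrr mul0r; exact.
Qed.

Lemma margin_positive_margins t : 1 / 5 <= t <= 5 -> positive_margins (margin t).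
Proof.
move=> /margin_normalized[a [b [m [n [hg h1 h2 h3 h4]]]]].
exists a, b, m, n; split; first exact/positive_ABMN_gaps.
by exists 0, 1, (margin t), 0; split=> //; rewrite !subr0 divr1.
Qed.

(** Each gap between [i] and [i + 1] is expressed from both ends, giving
    [2 a i + b i = a (i+1)^2 / b (i+1)] and its counterpart for [n]; eliminating the scale leaves
    the recursion for the ratios. *)
Lemma gaps_step a b m n i : site_gaps a b m n ->
  b (i + 1) / a (i + 1) = next_ratio (b i / a i) /\
  a (i + 1) = a i * (b (i + 1) / a (i + 1) * (2 + b i / a i)).
Proof.
move=> h; have [[a0 b0] e1 _ _ e2] := h i.
have [[a0' b0']] := h (i + 1); rewrite addrK => _ e3 e4 _.
have h1 : a (i + 1) ^+ 2 = (2 * a i + b i) * b (i + 1).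
  by rewrite -e1 e3; field; rewrite gt_eqF.
have h2 : b i ^+ 2 = (2 * b (i + 1) + a (i + 1)) * a i.
  by rewrite -e4 e2; field; rewrite gt_eqF.
split.
  apply: next_ratio_unique; rewrite ?divr_gt0//.
  rewrite [RHS](_ : _ = (b i ^+ 2) / a i ^+ 2); last by rewrite expr_div_n.
  rewrite h2.
  have -> : 2 + b i / a i = (a (i + 1) ^+ 2 / b (i + 1)) / a i.
    by rewrite h1; field; rewrite !gt_eqF.
  by field; rewrite !gt_eqF.
have -> : 2 + b i / a i = (a (i + 1) ^+ 2 / b (i + 1)) / a i.
  by rewrite h1; field; rewrite !gt_eqF.
by field; rewrite !gt_eqF.
Qed.

Lemma gaps_forward a b m n (k : nat) : site_gaps a b m n ->
  let t := b 0 / a 0 in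
  [/\ b k%:Z / a k%:Z = ratio k t, a k%:Z = a 0 * stake k t,
      m k%:Z = m 0 + a 0 * \sum_(j < k) m_gap j t &
      n k%:Z = n 0 - a 0 * \sum_(j < k) n_gap j t].
Proof.
move=> h t; elim: k => [|k [ih1 ih2 ih3 ih4]].
  by rewrite !big_ord0 !mulr0 addr0 subr0 mulr1.
have [s1 s2] := gaps_step k%:Z h; have [[a0 b0] e1 _ _ e2] := h k%:Z.
have ek : k.+1%:Z = k%:Z + 1 by lia.
have bk : b k%:Z = ratio k t * a k%:Z by rewrite -ih1 divfK ?gt_eqF.
split.
- by rewrite ek s1 ih1.
- by rewrite ek s2 s1 ih1 ih2 -mulrA.
- have -> : m k.+1%:Z = m k%:Z + (2 * a k%:Z + b k%:Z) by rewrite -e1 ek; ring.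
  by rewrite ih3 big_ord_recr/= bk ih2 /m_gap; ring.
- have -> : n k.+1%:Z = n k%:Z - b k%:Z ^+ 2 / a k%:Z by rewrite -e2 ek; ring.
  rewrite ih4 big_ord_recr/= bk.
  have -> : (ratio k t * a k%:Z) ^+ 2 / a k%:Z = ratio k t ^+ 2 * a k%:Z.
    by field; rewrite gt_eqF.
  by rewrite ih2 /n_gap; ring.
Qed.

Lemma gaps_limits a b m n (lm ln : R) : site_gaps a b m n -> 0 < b 0 / a 0 < 6 ->
  lim_pinfty m lm -> lim_pinfty n ln ->
  lm = m 0 + a 0 * m_tail (b 0 / a 0) /\ ln = n 0 - a 0 * n_tail (b 0 / a 0).
Proof.
move=> h ht hm hn; split.
- apply: (cvg_unique _ hm); first exact: Rhausdorff.
  rewrite (_ : (fun k : nat => m k%:Z) =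
    (fun k => m 0 + a 0 * \sum_(j < k) m_gap j (b 0 / a 0))).
    apply: cvgD; first exact: cvg_cst.
    by apply: cvgM; [exact: cvg_cst|exact: m_tail_cvg].
  by apply/funext => k; have [] := gaps_forward k h.
- apply: (cvg_unique _ hn); first exact: Rhausdorff.
  rewrite (_ : (fun k : nat => n k%:Z) =
    (fun k => n 0 - a 0 * \sum_(j < k) n_gap j (b 0 / a 0))).
    apply: cvgB; first exact: cvg_cst.
    by apply: cvgM; [exact: cvg_cst|exact: n_tail_cvg].
  by apply/funext => k; have [] := gaps_forward k h.
Qed.

(** The limits at [-oo] are read off the reflected solution, whose ratio at 0 is inverted and whose
    stake there is [b 0]. *)
Lemma gaps_margin a b m n (r : R) : site_gaps a b m n -> 1 / 5 <= b 0 / a 0 <= 5 ->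
  mina_margin m n r -> r = margin (b 0 / a 0).
Proof.
move=> h ht [mm [mp [nm [np [hmm hmp hnm hnp ->]]]]].
have [t0 h6 h6v _] := inv_fifth_five ht; have [[a0 b0] _ _ _ _] := h 0.
have [e1 e2] := gaps_limits h h6 hmp hnp.
have := gaps_limits (site_gaps_reflect h) _ (lim_pinfty_reflect hnm) (lim_pinfty_reflect hmm).
rewrite oppr0 -invf_div => /(_ h6v)[e3 e4].
rewrite e1 e2 e3 e4 /margin.
have d0 := margin_den_gt0 ht.
set s := b 0 / a 0 in d0 *; set u := m_tail s in d0 *; set v := n_tail s in d0 *.
set u' := m_tail s^-1; set v' := n_tail s^-1 in d0 *.
have -> : n 0 + b 0 * u' - (n 0 - a 0 * v) = a 0 * (v + s * u').
  by rewrite /s; field; rewrite gt_eqF.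
have -> : m 0 + a 0 * u - (m 0 - b 0 * v') = a 0 * (u + s * v').
  by rewrite /s; field; rewrite gt_eqF.
by rewrite -mulf_div divff ?mul1r// gt_eqF.
Qed.

Lemma gaps_ratio_descend a b m n : site_gaps a b m n -> 1 < b 0 / a 0 ->
  exists k : nat, 1 / 5 <= b k%:Z / a k%:Z <= 1.
Proof.
move=> h t1; set t := b 0 / a 0 in t1; have t0 : 0 < t by lra.
have [k0 hk0] : exists k, ratio k t <= 1.
  (* [ratio k t <= t / 4^k], and [t < k <= 4^k] for this [k]. *)
  exists (Num.trunc t).+1; apply: le_trans (ratio_le _ t0) _.
  rewrite ler_pdivrMr ?exprn_gt0// mul1r (le_trans (ltW (truncnS_gt t)))//.
  by rewrite -natrX ler_nat ltnW// ltn_expl.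
have [k kP kmin] := ex_minnP (ex_intro (fun k => ratio k t <= 1) k0 hk0).
exists k; have [-> _ _ _] := gaps_forward k h; rewrite -/t kP andbT.
(* [k = 0] is excluded by [t > 1]; otherwise minimality puts the preceding ratio above 1, and
   [next_ratio_ge] applies. *)
case: k kP kmin => [|k] kP kmin; first by move: kP; rewrite /ratio/=; lra.
apply: next_ratio_ge; rewrite leNgt; apply/negP => /ltW/kmin.
by rewrite ltnn.
Qed.

(** A ratio below 1 is inverted by reflection, so the descent lands in [[1/5, 1]] or, after
    reflecting back, in [[1, 5]]. *)
Lemma gaps_center a b m n : site_gaps a b m n ->
  exists k : int, 1 / 5 <= b k / a k <= 5.
Proof.
move=> h; have [[a0 b0] _ _ _ _] := h 0.
have [t1|t1] := ltP 1 (b 0 / a 0).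
  by have [k hk] := gaps_ratio_descend h t1; exists k%:Z; lra.
have [e|ne] := eqVneq (b 0 / a 0) 1; first by exists 0; rewrite e; lra.
have := gaps_ratio_descend (site_gaps_reflect h); rewrite oppr0 -invf_div.
rewrite invf_gt1 ?divr_gt0// lt_neqAle ne t1 => /(_ isT)[k hk].
exists (- k%:Z); rewrite -[b _ / a _]invf_div; move: hk; set s := a _ / b _ => /andP[h1 h2].
have hs : 1 / 5 <= s <= 5 by lra.
by have [_ _ _] := inv_fifth_five hs.
Qed.

Lemma positive_margin_exists (r : R) : positive_margins r ->
  exists2 t, 1 / 5 <= t <= 5 & r = margin t.
Proof.
move=> [a [b [m [n [/positive_ABMN_gaps h hr]]]]].
have [k hk] := gaps_center h.
exists (b k / a k) => //.
have := gaps_margin (site_gaps_shift k h); rewrite add0r; apply=> //.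
case: hr => mm [mp [nm [np [hmm hmp hnm hnp ->]]]].
exists mm, mp, nm, np; split=> //;
  by [exact: lim_minfty_shift|exact: lim_pinfty_shift].
Qed.

(** The set of margins is the image of the compact [[1/5, 5]] under a continuous function, so its
    infimum is a minimum. *)
Lemma lambda_attained : exists2 t : R, 1 / 5 <= t <= 5 & lambda R = margin t.
Proof.
have h15 : 1 / 5 <= 5 :> R by lra.
have cont : {within `[1 / 5, 5], continuous (@margin R)}.
  apply: continuous_in_subspaceT => t; rewrite inE/= in_itv/= => ht.
  exact: margin_continuous.
have [t ht tmin] := EVT_min h15 cont.
rewrite in_itv/= in ht.
exists t => //; apply/eqP; rewrite eq_le; apply/andP; split.
  apply: ge_inf; last exact: margin_positive_margins.
  exists 0 => _ /positive_margin_exists[s hs ->]; rewrite ltW//; exact: margin_gt0.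
apply: lb_le_inf; first by exists (margin t); exact: margin_positive_margins.
move=> _ /positive_margin_exists[s hs ->]; apply: tmin.
by rewrite in_itv.
Qed.

(** Intermediate values between a minimiser [t] and [t^-1], where the margin is inverted; the two
    points may come in either order. *)
Lemma margin_surjective (x : R) : lambda R <= x <= (lambda R)^-1 ->
  exists2 t, 1 / 5 <= t <= 5 & x = margin t.
Proof.
have [t ht ->] := lambda_attained; rewrite -marginV// => hx.
have [_ _ _ htv] := inv_fifth_five ht.
have cont u v : 1 / 5 <= u -> v <= 5 -> {within `[u, v], continuous (@margin R)}.
  move=> hu hv; apply: continuous_in_subspaceT => y; rewrite inE/= in_itv/= => hy.
  by apply: margin_continuous; lra.
have [le|/ltW le] := leP t t^-1.
  have [||s] := @IVT R (@margin R) t t^-1 x le; first by apply: cont; lra.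
    by case/andP: hx => hx1 hx2; rewrite ge_min hx1 le_max hx2 orbT.
  by rewrite in_itv/= => hs <-; exists s => //; lra.
have [||s] := @IVT R (@margin R) t^-1 t x le; first by apply: cont; lra.
  by case/andP: hx => hx1 hx2; rewrite ge_min hx1 orbT le_max hx2.
by rewrite in_itv/= => hs <-; exists s => //; lra.
Qed.

(** Inverses of margins are margins, so the upper bound is the lower bound for [x^-1]. *)
Lemma positive_margin_bounds (x : R) : positive_margins x ->
  lambda R <= x <= (lambda R)^-1.
Proof.
move=> hx; have [t ht et] := lambda_attained.
have lb (y : R) : positive_margins y -> lambda R <= y.
  move=> hy; apply: ge_inf => //.
  exists 0 => _ /positive_margin_exists[s hs ->]; rewrite ltW//; exact: margin_gt0.
rewrite lb//=; have [s hs es] := positive_margin_exists hx.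
have [_ _ _ hsv] := inv_fifth_five hs.
have := lb _ (margin_positive_margins hsv); rewrite marginV// -es => h.
have x0 : 0 < x by rewrite es margin_gt0.
have l0 : 0 < lambda R by rewrite et margin_gt0.
by rewrite -[leLHS]invrK lef_pV2 ?posrE ?invr_gt0.
Qed.

End Margins.

(** Standard(x) = Trail(0, 1, x, 0), with arbitrary fixed m_* <= 0 = m_{-oo}
    and n_* <= 0 = n_oo. *)
Theorem mainTheorem4 (R : realType) (x mstar nstar : R) :
  0 < x -> mstar <= 0 -> nstar <= 0 ->
  (exists Sm Sp : strategy R,
      [/\ time_invariant Sm, time_invariant Sp &
          nash_equilibrium 0 1 x 0 mstar nstar Sm Sp])
  <-> (lambda R <= x <= (lambda R)^-1).
Proof.
move=> x0 hm hn; split=> [[Sm [Sp [tm tp hN]]]|].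
  by apply: positive_margin_bounds; exact: nash_positive_margin tm tp hN.
move=> /margin_surjective[t ht ->].
have [a [b [m [n [hg h1 h2 h3 h4]]]]] := margin_normalized ht.
exists (const_strategy b), (const_strategy a); split=> //.
exact: nash_of_gaps hg h1 h2 h3 h4 hm hn.
Qed.
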